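(* Let $(M,\omega)$ be a smooth symplectic manifold (possibly with boundary), let $S \subset M \setminus \partial M$ be a hypersurface, and let $\psi \colon S \times I \to U \subset M$ be a thickening of $S$. For $\varepsilon \in I$ put $S_\varepsilon = \psi(S \times \{\varepsilon\})$, and let $\mathcal{P}(S_\varepsilon)$ be the set of closed characteristics on $S_\varepsilon$. If the Hofer--Zehnder capacity of $U$ satisfies $c_{\mathrm{HZ}}(U) < \infty$, then $$\mu\{\varepsilon \in I \mid \mathcal{P}(S_\varepsilon) \neq \emptyset\} = \mu(I),$$ where $\mu$ denotes Lebesgue measure on $\mathbb{R}$.
   Context: A hypersurface $S$ in $M$ is a smooth compact connected orientable codimension $1$ submanifold of $M \setminus \partial M$ without boundary. The distinguished line bundle of a hypersurface $S$ is $\mathcal{L}_S = \{(x,\xi) \in TS \mid \omega(\xi,\eta) = 0 \text{ for all } \eta \in T_xS\}$. A closed characteristic on $S$ is an embedded circle in $S$ all of whose tangent lines belong to $\mathcal{L}_S$. The set of closed characteristics on $S$ is denoted $\mathcal{P}(S)$. A thickening of $S$ is a smooth diffeomorphism $\psi \colon S \times I \to U \subset M$, where $I \subset \mathbb{R}$ is an open neighbourhood of $0$ and $U$ is an open subset of $M$, such that $\psi(x,0) = x$ for all $x \in S$. For an open subset $U \subset M$, let $\mathcal{H}(U)$ be the set of smooth functions $H \colon U \to [0,\max H]$ such that $H|_V = 0$ for some nonempty open set $V \subset U$, and $H|_{U \setminus K} = \max H$ for some compact set $K \subset U$. The Hamiltonian flow $\varphi_H^t$ of $H$ is the flow of the vector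 field $X_H$ defined by $\omega(X_H,\cdot) = -dH$. A function $H \in \mathcal{H}(U)$ is called HZ-admissible if the flow $\varphi_H^t$ has no non-constant $T$-periodic orbit with period $0 < T \le 1$. Let $\mathcal{H}_{\mathrm{HZ}}(U)$ be the set of HZ-admissible $H \in \mathcal{H}(U)$. The Hofer--Zehnder capacity of $U$ is $$c_{\mathrm{HZ}}(U) = \sup\{\max H \mid H \in \mathcal{H}_{\mathrm{HZ}}(U)\} \in [0,\infty].$$ *)

(* Defs.v *)
(* Manifolds have dimension n.+1, as a codimension-1 submanifold exists only  *)
(* in positive dimension.  Maps defined on part of a manifold are total       *)
(* functions constrained only on that part.                                   *)
From HB Require Import structures.
From mathcomp Require Import all_boot all_order all_algebra.
From mathcomp Require Import all_classical all_reals all_analysis.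

Set Implicit Arguments.
Unset Strict Implicit.
Unset Printing Implicit Defensive.

Import Order.TTheory GRing.Theory Num.Theory.
Import numFieldNormedType.Exports.

Local Open Scope classical_set_scope.
Local Open Scope ring_scope.

Section Calculus.
Context {R : realType} {E F : normedModType R}.

Fixpoint Ck (k : nat) (O : set E) (f : E -> F) : Prop :=
  {in O, continuous f} /\
  if k is k'.+1 then
    forall v : E, (forall x, O x -> derivable f x v) /\ Ck k' O ('D_v f)
  else True.

(* Smoothness on an arbitrary subset A, by local smooth extension; A will be
   open in E, or relatively open in a half-space. *)
Definition smooth_on (A : set E) (f : E -> F) : Prop :=
  forall x, A x -> exists (O : set E) (g : E -> F),
    [/\ open O, O x, forall k, Ck k O g & {in A `&` O, f =1 g}].

(* The derivative at x in direction v of a function known only on A.  It is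
   'D_v f x when A is a neighbourhood of x; at a boundary point of a half-space
   it is a two-sided or a one-sided limit, according to the direction of v. *)
Definition derive_in (A : set E) (f : E -> F) (x v : E) : F :=
  lim ((fun h : R => h^-1 *: (f (h *: v + x) - f x))
         @ within [set h | A (h *: v + x)] 0^').

End Calculus.

Section Manifolds.
Context (R : realType) (n : nat).

Definition half_space : set 'rV[R]_n.+1 := [set y | 0 <= y 0 0].

Record chart (T : Type) := Chart {
  cdom : set T;
  cmap :> T -> 'rV[R]_n.+1;
  cinv : 'rV[R]_n.+1 -> T }.

Definition cimg T (c : chart T) : set 'rV[R]_n.+1 := c @` cdom c.

Definition interior_chart T (c : chart T) : Prop := open (cimg c).

Definition boundary_chart T (c : chart T) : Prop :=
  exists2 O : set 'rV[R]_n.+1, open O & cimg c = O `&` half_space.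

Definition is_chart (T : topologicalType) (c : chart T) : Prop :=
  [/\ open (cdom c), interior_chart c \/ boundary_chart c,
      {in cdom c, cancel c (cinv c)},
      {in cdom c, continuous c} &
      {within cimg c, continuous (cinv c)}].

Definition compatible T (c c' : chart T) : Prop :=
  smooth_on (c @` (cdom c `&` cdom c')) (c' \o cinv c) /\
  smooth_on (c' @` (cdom c `&` cdom c')) (c \o cinv c').

Record manifold := Manifold {
  mcarrier :> topologicalType;
  atlas : set (chart mcarrier);
  manifold_hausdorff : hausdorff_space mcarrier;
  manifold_second_countable : @second_countable mcarrier;
  atlas_chart : forall c, atlas c -> is_chart c;
  atlas_cover : forall x : mcarrier, exists2 c, atlas c & cdom c x;
  atlas_compatible : forall c c', atlas c -> atlas c' -> compatible c c' }.

Context (M : manifold).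

(* Membership in the maximal atlas. *)
Definition smooth_chart (c : chart M) : Prop :=
  is_chart c /\ forall c', atlas c' -> compatible c c'.

(* Interior charts may also meet {y 0 0 = 0}, hence the condition that the image
   be relatively open in the half-space. *)
Definition boundary : set M :=
  [set x | exists c : chart M,
     [/\ smooth_chart c, boundary_chart c, cdom c x & c x 0 0 = 0]].

Definition smooth_from (F : normedModType R) (U : set M) (f : M -> F) : Prop :=
  forall c, atlas c -> smooth_on (c @` (cdom c `&` U)) (f \o cinv c).

Definition smooth_into (E : normedModType R) (A : set E) (f : E -> M) : Prop :=
  {within A, continuous f} /\
  forall c, atlas c -> smooth_on (A `&` f @^-1` cdom c) (c \o f).

Definition smooth_map (U : set M) (f : M -> M) : Prop :=
  forall c, atlas c -> smooth_into (c @` (cdom c `&` U)) (f \o cinv c).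

(* The tangent space at x is identified with 'rV[R]_n.+1 through a chart
   chosen once and for all around x. *)
Definition chart_at (x : M) : chart M := sval (cid2 (atlas_cover x)).

Definition velocity (g : R -> M) (t : R) : 'rV[R]_n.+1 :=
  derive1 (chart_at (g t) \o g) t.

Definition differential (U : set M) (H : M -> R) (x : M) (v : 'rV[R]_n.+1) : R :=
  let c := chart_at x in
  derive_in (c @` (cdom c `&` U)) (H \o cinv c : _ -> R^o) (c x) v.

(* The tangent vector at cinv c y having coordinates v in the chart c. *)
Definition chart_vector (c : chart M) (y v : 'rV[R]_n.+1) : 'rV[R]_n.+1 :=
  derive_in (cimg c) (chart_at (cinv c y) \o cinv c) y v.

(* A 2-form is given at each point x by its matrix in the chart chart_at x. *)
Definition pairing (w : M -> 'M[R]_n.+1) (x : M) (u v : 'rV[R]_n.+1) : R :=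
  (u *m w x *m v^T) 0 0.

Definition form_coord (w : M -> 'M[R]_n.+1) (c : chart M) (y : 'rV[R]_n.+1) :
    'M[R]_n.+1 :=
  \matrix_(i, j) pairing w (cinv c y) (chart_vector c y (delta_mx 0 i))
                                      (chart_vector c y (delta_mx 0 j)).

Definition smooth_form (w : M -> 'M[R]_n.+1) : Prop :=
  forall c, atlas c -> smooth_on (cimg c) (form_coord w c).

Definition form_partial (w : M -> 'M[R]_n.+1) c (y : 'rV[R]_n.+1)
    (i j k : 'I_n.+1) : R :=
  derive_in (cimg c) (fun z => form_coord w c z j k : R^o) y (delta_mx 0 i).

Definition closed_form (w : M -> 'M[R]_n.+1) : Prop :=
  forall c y, atlas c -> cimg c y -> forall i j k,
    form_partial w c y i j k + form_partial w c y j k i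
      + form_partial w c y k i j = 0.

Definition symplectic (w : M -> 'M[R]_n.+1) : Prop :=
  [/\ smooth_form w, closed_form w,
      forall x u v, pairing w x u v = - pairing w x v u &
      forall x u, (forall v, pairing w x u v = 0) -> u = 0].

(* A codimension-1 slice chart: S is {c x 0 0 = 0}, and the remaining n
   coordinates are the local coordinates of S. *)
Definition slice_chart (S : set M) (c : chart M) : Prop :=
  [/\ smooth_chart c, interior_chart c &
      forall x, cdom c x -> (S x <-> c x 0 0 = 0)].

Definition slice_jacobian (c c' : chart M) (x : M) : 'M[R]_n :=
  \matrix_(i, j)
    ('D_(delta_mx 0 (lift ord0 i)) (c' \o cinv c) (c x)) 0 (lift ord0 j).

Definition orientable (S : set M) : Prop :=
  exists A : set (chart M),
    [/\ A `<=` slice_chart S,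
        forall x, S x -> exists2 c, A c & cdom c x &
        forall c c' x, A c -> A c' -> S x -> cdom c x -> cdom c' x ->
          0 < \det (slice_jacobian c c' x)].

(* A connected manifold is nonempty by convention, whereas set0 is connected. *)
Definition hypersurface (S : set M) : Prop :=
  [/\ S `<=` ~` boundary,
      forall x, S x -> exists2 c, slice_chart S c & cdom c x,
      compact S,
      (S !=set0 /\ connected S) &
      orientable S].

(* A slice chart c of S yields coordinates on S * R: the slot 0, which is
   constantly 0 on S, is reused for the real coordinate. *)
Definition slice_point (c : chart M) (z : 'rV[R]_n.+1) : 'rV[R]_n.+1 :=
  \row_j (if j == ord0 then 0 else z 0 j).

Definition thickening (S : set M) (I : set R) (U : set M)
    (psi : M -> R -> M) : Prop :=
  [/\ open I /\ I 0,
      open U /\ [set psi x t | x in S & t in I] = U,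
      forall c, slice_chart S c ->
        smooth_into [set z | cimg c (slice_point c z) /\ I (z 0 0)]
          (fun z => psi (cinv c (slice_point c z)) (z 0 0)),
      (exists (rho : M -> M) (tau : M -> R),
        [/\ smooth_map U rho, smooth_from U (tau : _ -> R^o) &
            forall x t, S x -> I t ->
              rho (psi x t) = x /\ tau (psi x t) = t]) &
      forall x, S x -> psi x 0 = x].

(* For an embedded submanifold S, the velocities at x of smooth curves in S. *)
Definition tangent_space (S : set M) (x : M) : set 'rV[R]_n.+1 :=
  [set v | exists (J : set R) (g : R -> M),
     [/\ open J /\ J 0, smooth_into (J : set R^o) g, g @` J `<=` S,
         g 0 = x & velocity g 0 = v]].

Definition line_bundle (w : M -> 'M[R]_n.+1) (S : set M) (x : M) :
    set 'rV[R]_n.+1 :=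
  [set v | tangent_space S x v /\
     forall u, tangent_space S x u -> pairing w x v u = 0].

(* The circle is R/Z; it is compact, so that an injective immersion is an
   embedding. *)
Definition circle_embedding (g : R -> M) : Prop :=
  [/\ smooth_into (setT : set R^o) g,
      forall t, g (t + 1) = g t,
      {in `[0, 1[ &, injective g} &
      forall t, velocity g t != 0].

Definition closed_characteristics (w : M -> 'M[R]_n.+1) (S : set M) :
    set (set M) :=
  [set C | exists g : R -> M,
     [/\ circle_embedding g, range g = C, C `<=` S &
         forall t, line_bundle w S (g t) (velocity g t)]].

(* The functions of H(U), with m = max H. *)
Definition hamiltonian (U : set M) (H : M -> R) (m : R) : Prop :=
  [/\ smooth_from U (H : _ -> R^o),
      (forall x, U x -> 0 <= H x <= m) /\ (exists2 x, U x & H x = m),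
      (exists V : set M,
         [/\ open V, V !=set0, V `<=` U & forall x, V x -> H x = 0]) &
      (exists K : set M,
         [/\ compact K, K `<=` U & forall x, (U `\` K) x -> H x = m])].

Definition hamiltonian_vector (w : M -> 'M[R]_n.+1) (U : set M) (H : M -> R)
    (x : M) : set 'rV[R]_n.+1 :=
  [set v | forall u, pairing w x v u = - differential U H x u].

(* Orbits of the flow of X_H, defined for all times. *)
Definition hamiltonian_orbit (w : M -> 'M[R]_n.+1) (U : set M) (H : M -> R)
    (g : R -> M) : Prop :=
  continuous g /\
  forall t, [/\ U (g t), derivable (chart_at (g t) \o g) t 1 &
                hamiltonian_vector w U H (g t) (velocity g t)].

Definition hz_admissible (w : M -> 'M[R]_n.+1) (U : set M) (H : M -> R) : Prop :=
  forall (g : R -> M) (T : R),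
    0 < T <= 1 -> hamiltonian_orbit w U H g -> (forall t, g (t + T) = g t) ->
    forall s t, g s = g t.

Definition hz_capacity (w : M -> 'M[R]_n.+1) (U : set M) : \bar R :=
  ereal_sup [set m%:E | m in
    [set m | exists2 H, hamiltonian U H m & hz_admissible w U H]].

End Manifolds.

(* The domain of completed_lebesgue_measure: Lebesgue measurable sets, not only
   Borel sets. *)
Definition lebesgue_measurable (R : realType) (A : set R) : Prop :=
  ((wlength (@idfun R))^*)%mu.-cara.-measurable A.

(* Main.v *)
(** Let tau : U -> I be the second component of the inverse of psi, and let X be
    its Hamiltonian vector field.  It is tangent to the hypersurfaces S_e, has no
    zero, and its periodic orbits parametrize closed characteristics.  Let E_K be
    the set of those e for which X has a periodic orbit of period at most K in
    S_e.  A limit of such orbits is again one (their periods cannot tend to 0,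
    since X has no zero), hence E_K is closed in I.

    Let [a, b] be contained in I.  There is a smooth function f with |f'| <= K and
    f' = 0 off the open set ]a, b[ \ E_K, which is 0 somewhere in ]a, b[ and equal
    to a constant m outside, where m can be taken of the order of
    K mu(]a, b[ \ E_K).  A periodic orbit of f o tau lies in some level S_e, where it
    is an orbit of X run at the speed f'(e); hence it is constant or its period
    exceeds K / |f'(e)| >= 1.  So f o tau is admissible, m <= c_HZ(U), and
    mu(]a, b[ \ E_K) = O(1 / K).  Now let K tend to infinity. *)
Require Import Defs.
From HB Require Import structures.
From mathcomp Require Import all_boot all_order all_algebra.
From mathcomp Require Import all_classical all_reals all_analysis.
From mathcomp Require Import measurable_realfun ring lra.

Set Implicit Arguments.
Unset Strict Implicit.
Unset Printing Implicit Defensive.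

Import Order.TTheory GRing.Theory Num.Theory.
Import numFieldNormedType.Exports.

Local Open Scope classical_set_scope.
Local Open Scope ring_scope.

(** * Maps of class C^k *)

(** Orbits are curves defined for all times that satisfy the equation in charts. Their limits are
    taken pointwise along an ultrafilter inside a compact slab between two levels, and a confinement
    estimate in charts, uniform over the family, supplies the equicontinuity. That E_K is closed
    matters because its complement is then open: an open set is exhausted in measure by finitely
    many cells of a grid of equal mesh, and the profile climbs on these cells alone. Two points
    shape the rest. Only [S] is assumed to avoid the boundary of [M], so derivatives on [U] might be
    one-sided; the smooth left inverse of psi excludes this. And the set of levels with a closed
    characteristic is only known to contain the union of the E_K, so it may fail to be Borel; its
    complement in I is shown to have outer measure 0, whence the completed measure. *)

Section DirectionalDerivatives.
Context {R : realType} {E F : normedModType R}.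
Implicit Types (f : E -> F) (O : set E).

Lemma is_derive_line f (x v : E) (s : R) (l : F) :
  is_derive (s *: v + x) v f l ->
  is_derive s 1 (fun t : R => f (t *: v + x)) l.
Proof.
have e : (fun h : R => h^-1 *: (((fun t : R => f (t *: v + x)) \o shift s) (h *: 1)
             - f (s *: v + x)))
    = (fun h => h^-1 *: ((f \o shift (s *: v + x)) (h *: v) - f (s *: v + x))).
  by apply/funext => h /=; rewrite scalerDl addrA [h *: 1]mulr1.
by case=> d dl; split; rewrite /derivable /derive e.
Qed.

Lemma Ck_continuous k O f : Ck k O f -> {in O, continuous f}.
Proof. by case: k => [|k] []. Qed.

Lemma Ck_derivable k O f x v : Ck k.+1 O f -> O x -> derivable f x v.
Proof. by case=> _ /(_ v)[d _] /d. Qed.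

Lemma Ck_derive k O f v : Ck k.+1 O f -> Ck k O ('D_v f).
Proof. by case=> _ /(_ v)[]. Qed.

Lemma CkSW k O f : Ck k.+1 O f -> Ck k O f.
Proof.
elim: k f => [|k IH] f; first by case=> ? _.
case=> cf df; split=> // v; split; first by case: (df v).
by apply: IH; case: (df v).
Qed.

Lemma Ck_sub k O O' f : O' `<=` O -> Ck k O f -> Ck k O' f.
Proof.
move=> O'O; elim: k f => [|k IH] f [cf df].
  by split=> // x /set_mem/O'O/mem_set/cf.
split=> [x /set_mem/O'O/mem_set/cf //|v]; split=> [x /O'O|].
  by case: (df v) => + _; apply.
by apply: IH; case: (df v).
Qed.

(** [Ck] constrains the total function [f] at the points of the set only, so the condition can be
    checked point by point. It serves to glue the local extensions of [smooth_on]. *)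
Lemma Ck_local k O f :
  (forall x, O x -> exists O', O' x /\ Ck k O' f) -> Ck k O f.
Proof.
elim: k f => [|k IH] f loc.
  split=> // x /set_mem/loc[ O' [ O'x [cf _]]].
  by apply: cf; exact/mem_set.
split=> [x /set_mem/loc[ O' [ O'x [cf _]]]|v]; first by apply: cf; exact/mem_set.
split=> [x /loc[ O' [ O'x /Ck_derivable]]|]; first exact.
by apply: IH => x /loc[ O' [ O'x /Ck_derive]]; exists O'.
Qed.

Lemma Ck_eq k O f g : open O -> {in O, f =1 g} -> Ck k O f -> Ck k O g.
Proof.
move=> oO; elim: k f g => [|k IH] f g fg [cf df].
  split=> // x xO; rewrite /continuous_at -(fg _ xO).
  apply: cvg_trans (cf _ xO); apply: near_eq_cvg.
  by apply: filterS (open_nbhs_nbhs (conj oO (set_mem xO))) => y /mem_set/fg.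
have nfg x : O x -> \forall y \near x, f y = g y.
  move=> Ox; apply: filterS (open_nbhs_nbhs (conj oO Ox)) => y /mem_set.
  exact: fg.
split=> [x xO|v].
  rewrite /continuous_at -(fg _ xO).
  by apply: cvg_trans (cf _ xO); apply: near_eq_cvg; exact/nfg/set_mem.
case: (df v) => dv Dv; split=> [x Ox|].
  by apply: near_eq_derivable (dv _ Ox); exact: nfg.
by apply: IH Dv => x /set_mem Ox; apply: near_eq_derive; exact: nfg.
Qed.

Lemma smooth_on_sub (A B : set E) f : B `<=` A -> smooth_on A f -> smooth_on B f.
Proof.
move=> BA sf x /BA/sf[ O [g [oO Ox Og Ag]]]; exists O, g; split=> //.
by move=> y /set_mem[/BA Ay Oy]; apply: Ag; exact/mem_set.
Qed.

(** On an open set a local extension agrees with [f] near each point, so its derivatives are those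
    of [f] itself. *)
Lemma smooth_on_Ck (A : set E) f k : open A -> smooth_on A f -> Ck k A f.
Proof.
move=> oA sf; apply: Ck_local => x Ax.
have [ O [g [oO Ox Og Ag]]] := sf x Ax.
exists (A `&` O); split=> //; apply: (@Ck_eq _ _ g).
- exact: openI.
- by move=> y yAO; rewrite Ag.
- by apply: Ck_sub (Og k) => ? [].
Qed.

Lemma Ck_smooth_on (A : set E) f : open A -> (forall k, Ck k A f) ->
  smooth_on A f.
Proof. by move=> oA Af x Ax; exists A, f; split. Qed.

Lemma Ck_cst k O (a : F) : Ck k O (cst a).
Proof.
elim: k a => [|k IH] a.
  by split=> // x _; exact: cvg_cst.
split=> [x _|v]; first exact: cvg_cst.
split=> [x _|]; first exact: derivable_cst.
have -> : 'D_v (cst a) = cst 0 by apply/funext => x; rewrite derive_cst.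
exact: IH.
Qed.

Lemma Ck_add k O f g : open O -> Ck k O f -> Ck k O g -> Ck k O (f \+ g).
Proof.
move=> oO; elim: k f g => [|k IH] f g [cf df] [cg dg].
  by split=> // x xO; apply: cvgD; [exact: cf|exact: cg].
split=> [x xO|v]; first by apply: cvgD; [exact: cf|exact: cg].
case: (df v) (dg v) => dfv Dfv [dgv Dgv].
split=> [x Ox|]; first by apply: derivableD; [exact: dfv|exact: dgv].
apply: (@Ck_eq _ _ ('D_v f \+ 'D_v g)) => //.
  move=> x /set_mem Ox.
  by rewrite [RHS](deriveD (dfv x Ox) (dgv x Ox)).
exact: IH.
Qed.

End DirectionalDerivatives.

Section Scalar.
Context {R : realType} {E : normedModType R}.
Implicit Types (f : E -> R) (O : set E).

Lemma Ck_mul k O f g : open O -> Ck k O (f : E -> R^o) -> Ck k O (g : E -> R^o) ->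
  Ck k O (f \* g : E -> R^o).
Proof.
move=> oO; elim: k f g => [|k IH] f g fk gk.
  by split=> // x xO; apply: cvgM; [exact: (Ck_continuous fk xO)|exact: (Ck_continuous gk xO)].
split=> [x xO|v].
  by apply: cvgM; [exact: (Ck_continuous fk xO)|exact: (Ck_continuous gk xO)].
split=> [x Ox|].
  by apply: derivableM; [exact: (Ck_derivable fk Ox)|exact: (Ck_derivable gk Ox)].
apply: (@Ck_eq _ _ _ _ _ ((f \* 'D_v g) \+ (g \* 'D_v f) : E -> R^o)) => //.
  move=> x /set_mem Ox.
  by rewrite [RHS](deriveM (Ck_derivable fk Ox) (Ck_derivable gk Ox)).
apply: Ck_add => //; apply: IH => //; try exact: CkSW.
- exact: Ck_derive gk.
- exact: Ck_derive fk.
Qed.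

Lemma Ck_inv k O f : open O -> (forall x, O x -> f x != 0) ->
  Ck k O (f : E -> R^o) -> Ck k O ((fun x => (f x)^-1) : E -> R^o).
Proof.
move=> oO f0; elim: k => [|k IH] fk.
  split=> // x xO; apply: cvgV; [exact/f0/set_mem|exact: (Ck_continuous fk xO)].
split=> [x xO|v].
  by apply: cvgV; [exact/f0/set_mem|exact: (Ck_continuous fk xO)].
split=> [x Ox|].
  by apply: derivableV; [exact: f0|exact: (Ck_derivable fk Ox)].
pose g x := (f x)^-1.
apply: (@Ck_eq _ _ _ _ _ ((cst (-1) \* (g \* g)) \* 'D_v f : E -> R^o)) => //.
  move=> x /set_mem Ox.
  rewrite [RHS](deriveV (f0 x Ox) (Ck_derivable fk Ox)).
  by rewrite /= /g mulN1r -expr2 exprVn.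
have gk : Ck k O (g : E -> R^o) by apply: IH; exact: CkSW.
apply: Ck_mul => //; last exact: Ck_derive fk.
by apply: Ck_mul => //; [exact: Ck_cst|exact: Ck_mul].
Qed.

Lemma Ck_sum k O (I : Type) (r : seq I) (P : pred I) (h : I -> E -> R) :
  open O -> (forall i, Ck k O (h i : E -> R^o)) ->
  Ck k O ((fun x => \sum_(i <- r | P i) h i x) : E -> R^o).
Proof.
move=> oO hk; elim: r => [|i r IH].
  by under eq_fun do rewrite big_nil; exact: Ck_cst.
under eq_fun do rewrite big_cons.
by case: (P i) => //; apply: Ck_add.
Qed.

Lemma Ck_prod k O (I : Type) (r : seq I) (P : pred I) (h : I -> E -> R) :
  open O -> (forall i, Ck k O (h i : E -> R^o)) ->
  Ck k O ((fun x => \prod_(i <- r | P i) h i x) : E -> R^o).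
Proof.
move=> oO hk; elim: r => [|i r IH].
  by under eq_fun do rewrite big_nil; exact: Ck_cst.
under eq_fun do rewrite big_cons.
by case: (P i) => //; apply: Ck_mul.
Qed.

Lemma Ck_det k O m (A : E -> 'M[R]_m) :
  open O -> (forall i j, Ck k O ((fun x => A x i j) : E -> R^o)) ->
  Ck k O ((fun x => \det (A x)) : E -> R^o).
Proof.
move=> oO Ak; rewrite /determinant; apply: Ck_sum => // s.
by apply: Ck_mul => //; [exact: Ck_cst|exact: Ck_prod].
Qed.

Lemma continuous_mxP m n (A : E -> 'M[R]_(m, n)) (x : E) :
  {for x, continuous A} <-> forall i j, {for x, continuous (fun y => A y i j)}.
Proof.
split=> [cA i j|cA].
  by apply: (@continuous_comp _ _ _ A (fun M => M i j)) => //; exact: coord_continuous.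
apply/cvgrPdist_le => /= e e0.
near=> y.
rewrite /Num.Def.normr/= mx_normrE (bigmax_le _ (ltW e0))//= => i _.
rewrite !mxE/=.
move: i; near: y; apply: filter_forall => /= i.
by have /cvgrPdist_le := cA i.1 i.2; apply.
Unshelve. all: by end_near. Qed.

Lemma Ck_mxP k O m n (A : E -> 'M[R]_(m, n)) : open O ->
  Ck k O A <-> (forall i j, Ck k O ((fun x => A x i j) : E -> R^o)).
Proof.
move=> oO; elim: k A => [|k IH] A; split.
- by move=> [cA _] i j; split=> // x xO; exact: (continuous_mxP _ _).1 (cA x xO) i j.
- move=> Aij; split=> // x xO; apply/continuous_mxP => i j.
  by case: (Aij i j) => + _; apply.
- move=> Ak i j; split=> [x xO|v].
    exact: (continuous_mxP _ _).1 (Ck_continuous Ak xO) i j.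
  have dA x : O x -> derivable A x v by exact: Ck_derivable Ak.
  split=> [x /dA/derivable_mxP|]; first exact.
  apply: (@Ck_eq _ _ _ _ _ (fun x => 'D_v A x i j)) => //.
    by move=> x /set_mem/dA/derive_mx ->; rewrite mxE.
  by move: i j; apply/IH; exact: Ck_derive.
- move=> Aij; split=> [x xO|v].
    by apply/continuous_mxP => i j; exact: (Ck_continuous (Aij i j) xO).
  have dA x : O x -> derivable A x v.
    by move=> Ox; apply/derivable_mxP => i j; exact: (Ck_derivable (Aij i j) Ox).
  split=> //; apply/IH => i j.
  apply: (@Ck_eq _ _ _ _ _ ('D_v (fun x => A x i j))) => //.
    by move=> x /set_mem/dA/derive_mx ->; rewrite mxE.
  exact: Ck_derive.
Qed.

End Scalar.

(** * Total differentiability from continuous partial derivatives *)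

Section Differentiability.
Context {R : realType}.

Lemma MVT_at0 (g dg : R -> R) (c : R) :
  (forall t : R, `|t| <= `|c| -> is_derive t 1 g (dg t)) ->
  exists2 t, `|t| <= `|c| & g c - g 0 = dg t * c.
Proof.
move=> dgP; have cg t : `|t| <= `|c| -> {for t, continuous g}.
  by move=> /dgP[+ _] => /derivable1_diffP/differentiable_continuous.
have [c0|c0] := leP 0 c.
  have itv t : t \in `[0, c]%R -> `|t| <= `|c|.
    by rewrite in_itv/= => /andP[t0 tc]; rewrite !ger0_norm.
  have [||t tc gE] := @MVT_segment R g dg 0 c c0.
  - by move=> t /subset_itv_oo_cc/itv/dgP.
  - by apply: continuous_in_subspaceT => t /set_mem/itv/cg.
  - by exists t; [exact: itv|rewrite gE subr0].
have itv t : t \in `[c, 0]%R -> `|t| <= `|c|.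
  by rewrite in_itv/= => /andP[ct t0]; rewrite (ltr0_norm c0) ler0_norm// lerN2.
have [||t tc gE] := @MVT_segment R g dg c 0 (ltW c0).
- by move=> t /subset_itv_oo_cc/itv/dgP.
- by apply: continuous_in_subspaceT => t /set_mem/itv/cg.
- by exists t; [exact: itv|rewrite -opprB gE sub0r mulrN opprK].
Qed.

Lemma mx_norm_le m n (A : 'M[R]_(m, n)) (e : R) : 0 <= e ->
  (forall i j, `|A i j| <= e) -> `|A| <= e.
Proof.
by move=> e0 Ae; rewrite /Num.Def.normr/= mx_normrE (bigmax_le _ e0).
Qed.

Lemma le_mx_norm m n (A : 'M[R]_(m, n)) i j : `|A i j| <= `|A|.
Proof.
rewrite [leRHS]/Num.Def.normr/= mx_normrE.
exact: (le_bigmax _ (fun i => `|A i.1 i.2|) (i, j)).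
Qed.

Lemma differentiable_approx (V W : normedModType R) (f : V -> W)
    (D : {linear V -> W}) (x : V) : continuous D ->
  (forall eps : R, 0 < eps ->
     \forall h \near (0 : V), `|f (h + x) - f x - D h| <= eps * `|h|) ->
  differentiable f x.
Proof.
move=> cD fD; have Df : f \o shift x = cst (f x) + D +o_ 0 id.
  apply/eqaddoP => eps eps0; apply: filterS (fD _ eps0) => h.
  rewrite [X in _ -> `|X| <= _](_ : _ = f (h + x) - f x - D h)//.
  by rewrite /= opprD addrA.
by apply/diff_locallyP; rewrite (diff_unique cD Df).
Qed.

Section C1.
Context {n : nat} (O : set 'rV[R]_n) (f : 'rV[R]_n -> R^o).
Hypotheses (oO : open O) (fC1 : Ck 1 O f).

Let e (i : 'I_n) : 'rV[R]_n := delta_mx 0 i.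
Let D x (h : 'rV[R]_n) : R^o := \sum_i h 0 i * 'D_(e i) f x.
(** Truncation to the first [k] coordinates: the points [cut h k + x] form a path from [x] to
    [h + x] along the axes, on which the increment of [f] telescopes. *)
Let cut (h : 'rV[R]_n) (k : nat) : 'rV[R]_n :=
  \row_j (if (j < k)%N then h 0 j else 0).

Let cutS h (k : 'I_n) : cut h k.+1 = h 0 k *: e k + cut h k.
Proof.
apply/rowP => j; rewrite !mxE eqxx/= ltnS leq_eqVlt -(inj_eq val_inj) /=.
by case: ltngtP => [||/val_inj ->]; rewrite ?(mulr0, mulr1, addr0, add0r).
Qed.

Let D_linear x : linear (D x).
Proof.
move=> a u v; rewrite /D scaler_sumr -big_split/=; apply: eq_bigr => i _.
by rewrite !mxE mulrDl scalerAl.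
Qed.

Let D_continuous x : continuous (D x).
Proof.
move=> u; apply: differentiable_continuous.
have -> : D x = \sum_(i < n) (fun h : 'rV[R]_n => h 0 i * 'D_(e i) f x).
  by apply/funext => h; rewrite fct_sumE.
apply: (@differentiable_sum R 'rV[R]_n R^o n
  (fun i (h : 'rV[R]_n) => h 0 i * 'D_(e i) f x)) => i.
by apply: differentiableM => //; exact: differentiable_coord.
Qed.

Let step x (eps del : R) : 0 < del ->
  (forall y, `|y - x| < del -> O y) ->
  (forall y (i : 'I_n), `|y - x| < del ->
     `|'D_(e i) f y - 'D_(e i) f x| <= eps) ->
  forall h, `|h| < del -> `|f (h + x) - f x - D x h| <= n%:R * eps * `|h|.
Proof.
move=> d0 BO BD h hd.
(* In the max norm no point of the path is farther from [x] than [h + x], so the whole path stays in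
   the ball where the hypotheses hold. *)
have cut_lt k (t : R) : `|t| <= `|h 0 k| -> `|t *: e k + cut h k| <= `|h|.
  move=> th; apply: mx_norm_le => // i j; rewrite (ord1 i) !mxE eqxx/=.
  have [->|jk] := eqVneq j k.
    by rewrite ltnn mulr1 addr0 (le_trans th)// le_mx_norm.
  by rewrite mulr0 add0r; case: ifP => _; rewrite ?le_mx_norm ?normr0.
have -> : f (h + x) - f x = \sum_(k < n) (f (cut h k.+1 + x) - f (cut h k + x)).
  rewrite -(big_mkord xpredT (fun k => f (cut h k.+1 + x) - f (cut h k + x))).
  rewrite telescope_sumr//; congr (f (_ + _) - f _).
    by apply/rowP => j; rewrite mxE ltn_ord.
  by rewrite -[LHS]add0r; congr (_ + _); apply/rowP => j; rewrite !mxE ltn0.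
rewrite /D -sumrB (le_trans (ler_norm_sum _ _ _))//.
rewrite -mulrA mulr_natl -[X in _ *+ X]card_ord -sumr_const ler_sum// => k _.
pose g (t : R) := f (t *: e k + (cut h k + x)).
have gE (t : R) : `|t| <= `|h 0 k| ->
    is_derive t 1 g ('D_(e k) f (t *: e k + (cut h k + x))).
  move=> th; apply: is_derive_line; apply: derivableP.
  apply: (Ck_derivable fC1); apply: BO; rewrite addrA addrK.
  exact: le_lt_trans (cut_lt _ _ th) hd.
have [t th] := MVT_at0 gE.
rewrite {1 2}/g scale0r add0r addrA -cutS => ->.
rewrite mulrC -mulrBr normrM mulrC ler_pM// ?le_mx_norm//; apply: BD.
by rewrite addrA addrK; exact: le_lt_trans (cut_lt _ _ th) hd.
Qed.

(** [Ck] only asks for derivatives in each direction; the chain rule needs total differentiability,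
    which comes from the continuity of the partial derivatives. *)
Lemma C1_differentiable x : O x ->
  differentiable f x.
Proof.
move=> Ox.
pose DM := GRing.isLinear.Build _ _ _ _ _ (D_linear x).
pose DL : {linear _ -> _} := HB.pack (D x) DM.
apply: (@differentiable_approx _ _ f DL); first exact: D_continuous.
  move=> eps eps0.
  (* The errors of the [n] coordinate steps add up; [n.+1] keeps the denominator positive in
     dimension 0. *)
  have e'0 : 0 < eps / n.+1%:R by rewrite divr_gt0.
  have nO : \forall y \near x, O y by apply: open_nbhs_nbhs.
  have nD : \forall y \near x, forall i : 'I_n,
      `|'D_(e i) f y - 'D_(e i) f x| <= eps / n.+1%:R.
    apply: (@filter_forall _ _ (fun (i : 'I_n) y =>
      `|'D_(e i) f y - 'D_(e i) f x| <= eps / n.+1%:R) _ (nbhs_filter x)) => i.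
    have /Ck_continuous := Ck_derive (e i) fC1.
    move=> /(_ x (mem_set Ox))/cvgrPdist_le/(_ _ e'0).
    by apply: filterS => y; rewrite distrC.
  have [d /= d0 Bd] := (nbhs_ballP _ _).1 (filterI nO nD).
  have B y : `|y - x| < d -> ball x d y by rewrite -ball_normE/= distrC.
  have st := @step x _ _ d0 (fun y yd => (Bd y (B y yd)).1)
    (fun y i yd => (Bd y (B y yd)).2 i).
  apply/nbhs_ballP; exists d => //= h; rewrite -ball_normE/= sub0r normrN => hd.
  rewrite (le_trans (st _ hd))// ler_wpM2r// mulrCA ler_piMr ?(ltW eps0)//.
  by rewrite ler_pdivrMr// mul1r ler_nat.
Qed.

End C1.

Lemma differentiable_mxP (E : normedModType R) m n (A : E -> 'M[R]_(m, n)) x :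
  (forall i j, differentiable (fun y => A y i j) x) -> differentiable A x.
Proof.
move=> dA; have -> : A = \sum_i \sum_j (fun y => A y i j *: delta_mx i j).
  apply/funext => y; rewrite [LHS]matrix_sum_delta fct_sumE.
  by apply: eq_bigr => i _; rewrite fct_sumE.
by apply: differentiable_sum => i; apply: differentiable_sum => j;
  apply: differentiableZl.
Qed.

Lemma Ck_differentiable k n (O : set 'rV[R]_n) p q (f : 'rV[R]_n -> 'M[R]_(p, q)) x :
  open O -> Ck k.+1 O f -> O x -> differentiable f x.
Proof.
move=> oO fk Ox; have {fk}f1 : Ck 1 O f.
  by elim: k fk => // k IH /CkSW.
apply: differentiable_mxP => i j; apply: (C1_differentiable oO) => //.
exact: (Ck_mxP 1 _ oO).1.
Qed.

Lemma diff_row_sum n (F : normedModType R) (f : 'rV[R]_n -> F) x v :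
  differentiable f x -> 'd f x v = \sum_i v 0 i *: 'D_(delta_mx 0 i) f x.
Proof.
move=> df; rewrite {1}[v]row_sum_delta linear_sum; apply: eq_bigr => i _.
by rewrite linearZ deriveE.
Qed.

End Differentiability.

Section Composition.
Context {R : realType} {E : normedModType R}.

(** The derivative of the composite is a sum of products of coordinates of ['D_v f] with partial
    derivatives of [g] taken along [f], to which the induction applies. Differentiability of [f] is
    a hypothesis because its source is an arbitrary normed space. *)
Lemma Ck_comp_mx k n m p (O : set E) (O' : set 'rV[R]_n) (f : E -> 'rV[R]_n)
    (g : 'rV[R]_n -> 'M[R]_(m, p)) :
  open O -> open O' -> (forall x, O x -> O' (f x)) ->
  (forall x, O x -> differentiable f x) ->
  Ck k O f -> Ck k O' g -> Ck k O (g \o f).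
Proof.
move=> oO oO' fO df; elim: k m p g => [|k IH] m p g fk gk.
  split=> // x xO; apply: continuous_comp.
    exact: (Ck_continuous fk).
  by apply: (Ck_continuous gk); exact/mem_set/fO/set_mem.
have cf := Ck_continuous fk; have cg := Ck_continuous gk.
have dg x : O x -> differentiable g (f x).
  by move=> Ox; apply: (Ck_differentiable oO' gk); exact: fO.
split=> [x xO|v].
  by apply: continuous_comp; [exact: cf|exact/cg/mem_set/fO/set_mem].
split=> [x Ox|].
  by apply: diff_derivable; apply: differentiable_comp; [exact: df|exact: dg].
apply/(Ck_mxP _ _ oO) => i j.
apply: (@Ck_eq _ _ _ _ _ (fun x => \sum_l ('D_v f x) 0 l *
   ('D_(delta_mx 0 l) g \o f) x i j)) => //.
  move=> x /set_mem Ox; rewrite [in RHS]deriveE; last first.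
    by apply: differentiable_comp; [exact: (df x Ox)|exact: (dg x Ox)].
  rewrite (diff_comp (df x Ox) (dg x Ox))/=.
  rewrite (diff_row_sum _ (dg x Ox)).
  rewrite summxE; apply: eq_bigr => l _; by rewrite mxE (deriveE v (df x Ox)).
apply: Ck_sum => // l; apply: Ck_mul => //.
  by apply: (Ck_mxP _ _ oO).1; exact: Ck_derive fk.
apply: (Ck_mxP _ _ oO).1; apply: IH; [exact: CkSW|exact: Ck_derive].
Qed.

End Composition.

(** * Curves: chain rule and mean value inequality *)

Section Curves.
Context {R : realType}.

Lemma is_derive_mxP (V : normedModType R) m n (A : V -> 'M[R]_(m, n)) x v
    (l : 'M[R]_(m, n)) :
  is_derive x v A l <-> forall i j, is_derive x v (fun y => A y i j) (l i j).
Proof.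
split=> [[dA <-] i j|dA].
  have dAij := (derivable_mxP A x v).1 dA i j.
  by split=> //; rewrite derive_mx// mxE.
have dA' : derivable A x v.
  by apply/derivable_mxP => i j; case: (dA i j).
split=> //; rewrite derive_mx//; apply/matrixP => i j; rewrite mxE.
by case: (dA i j).
Qed.

Lemma is_derive_comp_curve (V W : normedModType R) (g : R -> V) (f : V -> W)
    (t : R) (u : V) :
  is_derive t 1 g u -> differentiable f (g t) ->
  is_derive t 1 (f \o g) ('d f (g t) u).
Proof.
move=> [/derivable1_diffP dg gu] df.
have dfg : differentiable (f \o g) t by exact: differentiable_comp.
split; first by apply/derivable1_diffP.
by rewrite deriveE// diff_comp//= -(deriveE (1 : R^o) dg) gu.
Qed.

Lemma is_derive_affine (V : normedModType R) (g : R -> V) (a b t : R) (u : V) :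
  is_derive (a * t + b) 1 g u -> is_derive t 1 (fun s => g (a * s + b)) (a *: u).
Proof.
move=> dg; have da : is_derive t 1 (fun s : R => a * s + b) a.
  rewrite (_ : (fun s => _) = (fun s : R => s *: (a : R^o) + b)).
    by apply: (@is_derive_line R R R id); rewrite /=; exact: is_derive_id.
  by apply/funext => s; rewrite /= [s *: _]mulrC.
case: dg => /derivable1_diffP dg <-.
have := is_derive_comp_curve da dg.
by rewrite (deriveE (1 : R^o) dg) -linearZ [a *: _]mulr1.
Qed.

(** Coordinatewise mean value theorem, which loses nothing in the max norm. The reference velocity
    [p] is 0 for a bound on displacement, and the expected derivative when a curve is to be
    differentiated. *)
Lemma curve_mvt n (g dg : R -> 'rV[R]_n) (s t e : R) (p : 'rV[R]_n) :
  s <= t -> 0 <= e ->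
  (forall u, s <= u <= t -> is_derive u 1 g (dg u)) ->
  (forall u, s <= u <= t -> `|dg u - p| <= e) ->
  `|g t - g s - (t - s) *: p| <= e * (t - s).
Proof.
move=> st e0 dgP dgp; have ts0 : 0 <= t - s by rewrite subr_ge0.
apply: mx_norm_le => [|i j]; first exact: mulr_ge0.
rewrite (ord1 i) !mxE {i}.
pose gj u := g u 0 j.
have dgj u : s <= u <= t -> is_derive u 1 gj (dg u 0 j).
  by move=> /dgP/is_derive_mxP; apply.
have [||u] := @MVT_segment R gj (fun u => dg u 0 j) s t st.
- by move=> u /subset_itv_oo_cc; rewrite in_itv/= => /dgj.
- apply: continuous_in_subspaceT => u /set_mem; rewrite /= in_itv/= => /dgj.
  by case=> /derivable1_diffP/differentiable_continuous.
rewrite in_itv/= /gj => /dgp uP ->.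
rewrite mulrC -mulrBr normrM (ger0_norm ts0) mulrC ler_wpM2r//.
by apply: le_trans uP; rewrite (le_trans _ (le_mx_norm _ 0 j))// !mxE.
Qed.

End Curves.

Section OneVariable.
Context {R : realType}.
Implicit Types (f g : R^o -> R^o).

Lemma Ck_comp_R (E : normedModType R) k (O : set E) (O' : set R^o) (f : E -> R^o) g :
  open O -> open O' -> (forall x, O x -> O' (f x)) ->
  (forall x, O x -> differentiable f x) ->
  Ck k O f -> Ck k O' g -> Ck k O (g \o f).
Proof.
move=> oO oO' fO df; elim: k g => [|k IH] g fk gk.
  split=> // x xO; apply: continuous_comp.
    exact: (Ck_continuous fk).
  by apply: (Ck_continuous gk); exact/mem_set/fO/set_mem.
have dg x : O x -> differentiable g (f x).
  by move=> Ox; apply/derivable1_diffP; apply: (Ck_derivable gk); exact: fO.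
have dgf x : O x -> differentiable (g \o f) x.
  by move=> Ox; apply: differentiable_comp; [exact: df|exact: dg].
split=> [x xO|v]; first exact/differentiable_continuous/dgf/set_mem.
split=> [x Ox|]; first exact/diff_derivable/dgf.
apply: (@Ck_eq _ _ _ _ _ ('D_v f \* ('D_1 g \o f))) => //.
  move=> x /set_mem Ox; rewrite [RHS]deriveE; last exact: dgf.
  rewrite (diff_comp (df x Ox) (dg x Ox))/=.
  rewrite (deriveE v (df x Ox)) (deriveE (1 : R^o) (dg x Ox)).
  by rewrite -[X in _ = 'd _ _ X]mulr1 [RHS]linearZ.
apply: Ck_mul => //; first exact: Ck_derive fk.
by apply: IH; [exact: CkSW|exact: Ck_derive].
Qed.

Lemma Ck_id (V : normedModType R) k (O : set V) : Ck k O (id : V -> V).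
Proof.
case: k => [|k]; first by split=> // x _; exact: cvg_id.
split=> [x _|v]; first exact: cvg_id.
split=> [x _|]; first exact: derivable_id.
have -> : 'D_v (id : V -> V) = cst v by apply/funext => x; rewrite derive_id.
exact: Ck_cst.
Qed.

Lemma Ck_R_differentiable k f (x : R) : Ck k.+1 setT f -> differentiable f x.
Proof. by move=> fk; apply/derivable1_diffP; exact: (Ck_derivable fk). Qed.

Lemma Ck_compT f g : (forall k, Ck k setT f) -> (forall k, Ck k setT g) ->
  forall k, Ck k setT (g \o f).
Proof.
move=> fk gk k; apply: (Ck_comp_R openT openT) => // x _.
exact: (Ck_R_differentiable x (fk 1%N)).
Qed.

Lemma Ck_affine (a b : R) k : Ck k setT (fun x : R^o => a * x + b : R^o).
Proof.
apply: (Ck_add openT); last exact: Ck_cst.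
by apply: (Ck_mul openT); [exact: Ck_cst|exact: Ck_id].
Qed.

Lemma derive_comp_R f g (x : R) : differentiable f x -> differentiable g (f x) ->
  'D_1 (g \o f) x = 'D_1 g (f x) * 'D_1 f x.
Proof.
move=> df dg; rewrite deriveE; last exact: differentiable_comp.
rewrite (diff_comp df dg)/= (deriveE (1 : R^o) dg) (deriveE (1 : R^o) df).
by rewrite -[X in 'd _ _ X = _]mulr1 [LHS]linearZ [LHS]mulrC.
Qed.

End OneVariable.

(** * Smooth functions on the line *)

Section SmoothStep.
Context {R : realType}.
Implicit Types (p : {poly R}) (x : R).

(* A family closed under differentiation. *)
Let flat p : R^o -> R^o :=
  fun x => if 0 < x then p.[x^-1] * expR (- x^-1) else 0.

(** From exp y = exp (y / (i + 1)) ^ (i + 1) >= (y / (i + 1)) ^ (i + 1). *)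
Lemma expr_mul_expRN_le (i : nat) (y : R) : 0 < y ->
  y ^+ i * expR (- y) <= i.+1%:R ^+ i.+1 / y.
Proof.
move=> y0; rewrite ler_pdivlMr// mulrAC -exprSr expRN ler_pdivrMr ?expR_gt0//.
have -> : expR y = expR (y / i.+1%:R) ^+ i.+1.
  by rewrite -expRM_natr divfK.
rewrite -exprMn; apply: lerXn2r; rewrite ?nnegrE ?(ltW y0)//.
rewrite -ler_pdivrMl// mulrC; apply: le_trans (expR_ge1Dx _).
by rewrite lerDr.
Qed.

Let flat_le p : exists C : R, forall x, `|flat p x| <= C * `|x|.
Proof.
exists (\sum_(i < size p) `|p`_i| * i.+1%:R ^+ i.+1) => x; rewrite /flat.
case: ifPn => [x0|_]; last first.
  by rewrite normr0 mulr_ge0// sumr_ge0// => i _; rewrite mulr_ge0.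
rewrite horner_coef mulr_suml (le_trans (ler_norm_sum _ _ _))//.
rewrite mulr_suml ler_sum// => i _.
have y0 : 0 < x^-1 by rewrite invr_gt0.
rewrite -!mulrA normrM ler_wpM2l// ger0_norm; last first.
  by rewrite mulr_ge0 ?expR_ge0// exprn_ge0// ltW.
by rewrite (gtr0_norm x0) -[x in leRHS]invrK; exact: expr_mul_expRN_le.
Qed.

Let flat0 p : flat p 0 = 0. Proof. by rewrite /flat ltxx. Qed.

(** With y = 1 / x and y' = - y^2, the derivative of p(y) exp(- y) is y^2 (p - p')(y) exp(- y). *)
Let dpoly p : {poly R} := 'X^2 * (p - p^`()).

Let flat_derive p x : is_derive x 1 (flat p) (flat (dpoly p) x).
Proof.
have [x0|x0|->] := ltgtP x 0.
- apply: (near_eq_is_derive (f := cst 0)).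
    have : \forall y \near x, y < 0 by exact: lt_nbhsl.
    by apply: filterS => y y0; rewrite /flat ltNge (ltW y0).
  by rewrite /flat ltNge (ltW x0)/=; exact: is_derive_cst.
- pose q y : R := p.[y] * expR (- y).
  apply: (near_eq_is_derive (f := q \o (fun y => y^-1))).
    have : \forall y \near x, 0 < y by exact: lt_nbhsr.
    by apply: filterS => y y0; rewrite /flat y0.
  have xn0 : x != 0 by rewrite gt_eqF.
  have dq : is_derive x^-1 1 q ((p^`()).[x^-1] * expR (- x^-1) - p.[x^-1] * expR (- x^-1)).
    have dp : is_derive x^-1 1 (horner p) (p^`()).[x^-1].
      exact: is_derive_poly.
    have de : is_derive x^-1 1 (expR \o -%R) (- expR (- x^-1)).
      apply: is_derive_eq; last by rewrite mulrN1.
    apply: (is_derive_eq (is_deriveM dp de)); rewrite /= /GRing.scale/= mulrN.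
    by rewrite addrC [expR _ * _]mulrC.
  have dV : is_derive x 1 (fun y : R => y^-1) (- x ^- 2).
    have [dV DV] := @is_deriveV _ (id : R -> R) x 1 1 xn0 (is_derive_id _ _).
    by split=> //; rewrite [LHS]DV [_ *: _]mulr1.
  have /derivable1_diffP dq' := @ex_derive _ _ _ _ _ _ _ dq.
  apply: (is_derive_eq (is_derive_comp_curve dV dq')).
  rewrite -[- x ^- 2]mulr1 -[_ * 1]/(_ *: (1 : R^o)) linearZ.
  rewrite -deriveE; last by apply/derivable1_diffP; case: dq.
  case: dq => _ ->; rewrite /flat x0 /dpoly hornerM hornerD hornerN hornerXn.
  by rewrite -mulrBl -exprVn [LHS]mulrA mulNr -mulrN opprB.
(* The difference quotient of [flat p] at 0 is [flat ('X * p)], which tends to 0 by the linear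
   bound. *)
- rewrite flat0; have [C PC] := flat_le ('X * p).
  have lim0 : (fun h : R => h^-1 *: (flat p (h + 0) - flat p 0)) @ 0^' --> (0 : R^o).
    have C0 : 0 <= C.
      by have := le_trans (normr_ge0 _) (PC 1); rewrite normr1 mulr1.
    apply/cvgrPdist_le => e e0.
    have eC0 : 0 < e / (C + 1) by rewrite divr_gt0// ltr_wpDl.
    near=> h.
    rewrite sub0r normrN addr0 flat0 subr0 /GRing.scale/=.
    have -> : h^-1 * flat p h = flat ('X * p) h.
      rewrite /flat; case: ifP; rewrite ?mulr0// => _.
      by rewrite hornerM hornerX mulrA.
    apply: le_trans (PC h) _.
    apply: (@le_trans _ _ ((C + 1) * `|h|)); first by rewrite ler_wpM2r// lerDl.
    rewrite mulrC -ler_pdivlMr; last by rewrite ltr_wpDl.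
    by near: h; exact: dnbhs0_le.
  have D0 : (fun h : R => h^-1 *: ((flat p \o shift 0) (h *: (1 : R^o)) - flat p 0))
      @ 0^' --> (0 : R^o).
    apply: cvg_trans lim0; apply: near_eq_cvg; near=> h.
    by rewrite /= [h *: _]mulr1.
  split; last exact/cvg_lim.
  by apply/cvg_ex; exists 0.
Unshelve. all: by end_near. Qed.

Let flat_Ck p k : Ck k setT (flat p).
Proof.
have cf p' (x : R^o) : x \in setT -> {for x, continuous (flat p')}.
  move=> _; apply/differentiable_continuous/derivable1_diffP.
  by case: (flat_derive p' x).
elim: k p => [|k IH] p; first by split=> // x; exact: cf.
split=> [x|v]; first exact: cf.
have df x : differentiable (flat p) x.
  by apply/derivable1_diffP; case: (flat_derive p x).
split=> [x _|]; first exact: diff_derivable.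
rewrite (_ : 'D_v _ = (cst (v : R^o)) \* flat (dpoly p)).
  by apply: (Ck_mul openT); [exact: Ck_cst|exact: IH].
apply/funext => x; rewrite deriveE// -[X in 'd _ _ X]mulr1 linearZ/=.
by rewrite -deriveE//; case: (flat_derive p x) => _ ->.
Qed.

Lemma smooth_step : exists (s : R^o -> R^o) (C : R),
  [/\ forall k, Ck k setT s, forall x, 0 <= s x <= 1,
      forall x, x <= 0 -> s x = 0, forall x, 1 <= x -> s x = 1 &
      [/\ 0 < C, forall x, `|'D_1 s x : R| <= C &
          forall x, 'D_1 s x != 0 -> 0 < x < 1]].
Proof.
(* The denominator is positive because [x] and [1 - x] are never both nonpositive. *)
pose th := flat 1; pose den x : R^o := th x + th (1 - x).
have th_ge0 x : 0 <= th x.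
  by rewrite /th /flat; case: ifP => // _; rewrite hornerC mul1r expR_ge0.
have th_gt0 x : 0 < x -> 0 < th x.
  by move=> x0; rewrite /th /flat x0 hornerC mul1r expR_gt0.
have th_eq0 x : x <= 0 -> th x = 0 by rewrite /th /flat leNgt; case: ifP.
have den_gt0 x : 0 < den x.
  have [x0|x0] := ltP 0 x; first by rewrite ltr_pwDl// th_gt0.
  by rewrite ltr_wpDl// th_gt0// subr_gt0 (le_lt_trans x0).
pose s x : R^o := th x * (den x)^-1.
have sk k : Ck k setT s.
  apply: (Ck_mul openT); first exact: flat_Ck.
  apply: (Ck_inv openT) => [x _|]; first by rewrite gt_eqF.
  apply: (Ck_add openT); first exact: flat_Ck.
  apply: (@Ck_compT _ (fun x : R^o => 1 - x : R^o)); last exact: flat_Ck.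
  move=> j; rewrite (_ : (fun x => _) = (fun x : R^o => -1 * x + 1 : R^o)).
    exact: Ck_affine.
  by apply/funext => x; rewrite mulN1r addrC.
have s01 x : 0 <= s x <= 1.
  rewrite /s mulr_ge0 ?invr_ge0 ?(ltW (den_gt0 x))//=.
  by rewrite ler_pdivrMr// mul1r lerDl.
have s0 x : x <= 0 -> s x = 0 by move=> x0; rewrite /s th_eq0// mul0r.
have s1 x : 1 <= x -> s x = 1.
  move=> x1; rewrite /s /den (th_eq0 (1 - x)) ?subr_le0// addr0 divff//.
  by rewrite gt_eqF// th_gt0// (lt_le_trans _ x1).
have ds x : derivable s x 1 by exact: (Ck_derivable (sk 1%N)).
have x11 x : x - 1 <= x + 1 by rewrite lerD2l (le_trans _ ler01)// lerN10.
have xI x : x \in `]x - 1, x + 1[%R by rewrite in_itv/= ltrBlDr ltrDl ltr01.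
(* Outside ]0, 1[, end points included, [s] attains its minimum or its maximum, so its derivative
   vanishes. *)
have Ds0 x : x <= 0 -> 'D_1 s x = 0.
  move=> /s0 sx; apply: (@derive_val _ _ _ _ _ s).
  apply: (derive1_at_min (x11 x) _ (xI x)) => [t _|t _]; first exact: ds.
  by rewrite sx; case/andP: (s01 t).
have Ds1 x : 1 <= x -> 'D_1 s x = 0.
  move=> /s1 sx; apply: (@derive_val _ _ _ _ _ s).
  apply: (derive1_at_max (x11 x) _ (xI x)) => [t _|t _]; first exact: ds.
  by rewrite sx; case/andP: (s01 t).
have cD : continuous (fun x => `|'D_1 s x| : R^o).
  move=> x; apply: cvg_norm.
  exact: (Ck_continuous (Ck_derive (1 : R^o) (sk 1%N)) (in_setT x)).
(* As the derivative vanishes off ]0, 1[, its maximum over [0, 1] bounds it everywhere; adding 1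
   makes the bound positive. *)
have [c _ cP] := @EVT_max R _ 0 1 ler01 (continuous_subspaceT cD).
have n0 x : 'D_1 s x = 0 -> `|'D_1 s x : R| = 0 by move=> ->; exact: (@normr0 R R).
have C0 : 0 <= `|'D_1 s c : R| + 1 by rewrite addr_ge0.
exists s, (`|'D_1 s c : R| + 1); split=> //; split=> [|x|x].
- exact: ltr_wpDl.
- have [/Ds0/n0 ->//|x0] := leP x 0.
  have [/Ds1/n0 ->//|x1] := leP 1 x.
  by rewrite ler_wpDr//; apply: cP; rewrite in_itv/= !ltW.
- apply: contraNT; rewrite negb_and -!leNgt => /orP[/Ds0|/Ds1] ->; exact: eqxx.
Qed.

End SmoothStep.

(** * Profiles that vary only inside a prescribed set *)

Section Plateau.
Context {R : realType}.

(** The bottom of the well is an interval around 1/2, not a point: it yields the open set on which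
    the Hamiltonian has to vanish. *)
Lemma well_profile : exists (chi : R^o -> R^o) (C : R),
  [/\ forall k, Ck k setT chi, forall x, 0 <= chi x <= 1,
      forall x, x <= 0 \/ 1 <= x -> chi x = 1,
      forall x, 1 / 4 <= x <= 3 / 4 -> chi x = 0 &
      0 < C /\ forall x, `|'D_1 chi x : R| <= C].
Proof.
have [s [C [sk s01 s0 s1 [C0 Cs _]]]] := @smooth_step R.
(* [l] rises from 0 to 1 on [1/8, 1/4] and [r] falls from 1 to 0 on [3/4, 7/8]. Each has slope at
   most [8 * C], hence the bound [16 * C] for 1 - l r. *)
pose l (x : R) : R^o := s (8 * x + -1); pose r (x : R) : R^o := s (-8 * x + 7).
have lk k : Ck k setT l.
  by apply: (Ck_compT (f := fun x : R^o => 8 * x + -1 : R^o)) => // j; exact: Ck_affine.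
have rk k : Ck k setT r.
  by apply: (Ck_compT (f := fun x : R^o => -8 * x + 7 : R^o)) => // j; exact: Ck_affine.
have ds (x : R) : is_derive x 1 s ('D_1 s x).
  by apply: derivableP; exact: (Ck_derivable (sk 1%N)).
have dl (x : R) : is_derive x 1 l (8 * 'D_1 s (8 * x + -1)).
  exact: is_derive_affine.
have dr (x : R) : is_derive x 1 r (-8 * 'D_1 s (-8 * x + 7)).
  exact: is_derive_affine.
exists (fun x => 1 + -1 * (l x * r x)), (16 * C).
have lr01 x : 0 <= l x * r x <= 1.
  have /andP[l0 l1] := s01 (8 * x + -1); have /andP[r0 r1] := s01 (-8 * x + 7).
  by rewrite mulr_ge0//= mulr_ile1.
split.
- move=> k; apply: (Ck_add openT); first exact: Ck_cst.
  apply: (Ck_mul openT); first exact: Ck_cst.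
  exact: (Ck_mul openT).
- by move=> x; have := lr01 x; lra.
- move=> x; rewrite /l /r => -[x0|x1].
    by rewrite [s (8 * x + _)]s0 ?mul0r ?mulr0 ?addr0//; lra.
  by rewrite [s (-8 * x + _)]s0 ?mulr0 ?addr0//; lra.
- move=> x x14; rewrite /l /r s1; last by lra.
  by rewrite s1; [rewrite !mulr1 subrr|lra].
- split=> [|x]; first by rewrite mulr_gt0.
  have dlr := is_deriveM (dl x) (dr x).
  have D : is_derive x 1 (fun x => 1 + -1 * (l x * r x) : R^o)
     (-1 * (l x * (-8 * 'D_1 s (-8 * x + 7)) + r x * (8 * 'D_1 s (8 * x + -1)))).
    have := is_deriveD (is_derive_cst (1 : R^o) x 1) (is_deriveZ (-1) dlr).
    by rewrite add0r.
  rewrite (@derive_val _ _ _ _ _ _ _ D) mulN1r normrN.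
  have /andP[l0 l1] := s01 (8 * x + -1); have /andP[r0 r1] := s01 (-8 * x + 7).
  rewrite (le_trans (ler_normD _ _))//.
  rewrite (_ : 16 * C = 8 * C + 8 * C); last by ring.
  apply: lerD; rewrite 2!normrM ?normrN (ger0_norm l0, ger0_norm r0) (ger0_norm (_ : 0 <= 8))//.
    by rewrite (le_trans (ler_piMl _ l1)) ?mulr_ge0// ler_wpM2l.
  by rewrite (le_trans (ler_piMl _ r1)) ?mulr_ge0// ler_wpM2l.
Qed.

(* f is m * chi o G, where G rises by equal steps from 0 to 1 on the good cells; the
   symmetric well chi makes f equal to m at both ends. *)
Lemma plateau : exists2 C : R, 0 < C &
  forall (V : set R) (a h K : R) (N : nat) (good : pred 'I_N), 0 < h -> 0 < K ->
  (forall (i : 'I_N) x, good i -> a + i%:R * h <= x <= a + i.+1%:R * h -> V x) ->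
  (0 < #|good|)%N ->
  let m := K * h * #|good|%:R / C in
  exists f : R^o -> R^o,
  [/\ forall k, Ck k setT f, forall x : R, 0 <= f x <= m,
      forall x : R, x <= a \/ a + N%:R * h <= x -> f x = m,
      exists c r : R, [/\ a <= c <= a + N%:R * h, 0 < r & forall y, `|y - c| < r -> f y = 0] &
      forall x : R, `|'D_1 f x : R| <= K /\ ('D_1 f x != 0 -> V x)].
Proof.
have [s [C [sk s01 s0 s1 [C0 Cs sn0]]]] := @smooth_step R.
have [chi [D [chik chi01 chi1 chi0 [D0 Dchi]]]] := well_profile.
exists (D * C) => [|V a h K N good h0 K0 goodV n0 m]; first exact: mulr_gt0.
set n := #|good| in n0 m *.
have n0' : (0 : R) < n%:R by rewrite ltr0n.
pose b (i : 'I_N) : R := - (h^-1 * a) - i%:R.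
pose w (i : 'I_N) : R := if good i then n%:R^-1 else 0.
pose G (x : R^o) : R^o := \sum_(i < N) w i * s (h^-1 * x + b i).
have Gk k : Ck k setT G.
  apply: (Ck_sum _ _ openT) => i; apply: (Ck_mul openT); first exact: Ck_cst.
  apply: (Ck_compT (f := fun x : R^o => h^-1 * x + b i : R^o)) => // j.
  exact: Ck_affine.
have w_ge0 i : 0 <= w i by rewrite /w; case: ifP => // _; rewrite invr_ge0 ltW.
have sum_w : \sum_i w i = 1.
  rewrite /w -big_mkcond/= sumr_const -/n -[_ *+ n]mulr_natr mulVf//.
  by rewrite gt_eqF.
have hb x i : h^-1 * x + b i = (x - (a + i%:R * h)) / h.
  by rewrite /b; field; rewrite gt_eqF.
have G0 x : x <= a -> G x = 0.
  move=> xa; rewrite /G big1// => i _; rewrite s0 ?mulr0// hb.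
  rewrite pmulr_lle0 ?invr_gt0// subr_le0 (le_trans xa)// lerDl.
  by rewrite mulr_ge0// ltW.
have G1 x : a + N%:R * h <= x -> G x = 1.
  move=> xa; rewrite /G -sum_w; apply: eq_bigr => i _; rewrite s1 ?mulr1// hb.
  rewrite ler_pdivlMr// mul1r lerBrDl (le_trans _ xa)//.
  rewrite -addrA lerD2l -[X in _ + X]mul1r -mulrDl ler_wpM2r ?(ltW h0)// natr1.
  by rewrite ler_nat.
have ds (x : R) : is_derive x 1 s ('D_1 s x).
  by apply: derivableP; exact: (Ck_derivable (sk 1%N)).
pose dG x : R := \sum_i w i * (h^-1 * 'D_1 s (h^-1 * x + b i)).
have GE (x : R) : is_derive x 1 G (dG x).
  rewrite (_ : G = \sum_(i < N) (fun x => w i * s (h^-1 * x + b i) : R^o)).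
    apply: is_derive_sum => i.
    have H := is_derive_affine (ds (h^-1 * x + b i)).
    exact: (is_deriveZ (w i) H).
  by apply/funext => y; rewrite fct_sumE.
(* The steps vary on disjoint open cells, so at most one summand of [dG x] is nonzero: the slope of
   [G] is that of a single step. *)
have dG_V x : dG x != 0 -> exists i, [/\ good i, 0 < h^-1 * x + b i < 1 &
    dG x = n%:R^-1 * (h^-1 * 'D_1 s (h^-1 * x + b i))].
  have [[i /andP[gi xi]] _|no] := pselect (exists i, good i && (0 < h^-1 * x + b i < 1)).
    exists i; split=> //; rewrite /dG (bigD1 i)//= big1 ?addr0; first by rewrite /w gi.
    move=> j ji; have [->|/sn0 xj] := eqVneq ('D_1 s (h^-1 * x + b j)) 0.
      by rewrite [_ * 0]mulr0 mulr0.
    suff ij : i = j by rewrite ij eqxx in ji.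
    move: xi xj; rewrite /b; set y := h^-1 * x => xi xj.
    have ij1 : (i%:R : R) < j.+1%:R by rewrite -natr1; lra.
    have ji1 : (j%:R : R) < i.+1%:R by rewrite -natr1; lra.
    rewrite ltr_nat ltnS in ij1; rewrite ltr_nat ltnS in ji1.
    by apply/val_inj/eqP; rewrite eqn_leq ij1.
  case/eqP; rewrite /dG big1// => i _.
  rewrite /w; case: ifPn => gi; last by rewrite mul0r.
  have [->|/sn0 xi] := eqVneq ('D_1 s (h^-1 * x + b i)) 0.
    by rewrite [_ * 0]mulr0 mulr0.
  by exfalso; apply: no; exists i; rewrite gi.
have dG_le x : `|dG x| <= C / (n%:R * h).
  have [->|/dG_V[i [gi xi ->]]] := eqVneq (dG x) 0.
    by rewrite normr0 divr_ge0 ?mulr_ge0 // ltW.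
  rewrite 2!normrM 2!normfV (gtr0_norm n0') (gtr0_norm h0) mulrA -invfM mulrC.
  by rewrite ler_wpM2r// invr_ge0 mulr_ge0// ltW.
have m0 : 0 < m by rewrite /m !divr_gt0 ?mulr_gt0.
exists (fun x => m * chi (G x)).
have cG : continuous G.
  by move=> x; apply: (Ck_continuous (Gk 0%N)); rewrite inE.
have dchi (x : R) : is_derive x 1 chi ('D_1 chi x).
  by apply: derivableP; exact: (Ck_derivable (chik 1%N)).
split.
- move=> k; apply: (Ck_mul openT); first exact: Ck_cst.
  exact: (Ck_compT Gk chik).
- move=> x; have /andP[c0 c1] := chi01 (G x).
  by rewrite mulr_ge0 ?(ltW m0)//= ler_piMr// ltW.
- by move=> x [/G0|/G1] ->; rewrite chi1 ?mulr1//; [left|right].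
- have aN : a <= a + N%:R * h by rewrite lerDl mulr_ge0// ltW.
  (* [G] climbs from 0 to 1, hence takes the value 1/2; as long as it stays within 1/4 of it, [chi]
     vanishes. *)
  have [] := @IVT R G a (a + N%:R * h) (1 / 2) aN (continuous_subspaceT cG).
    rewrite G0// G1//; apply/andP; split; rewrite ?ge_min ?le_max; lra.
  move=> c cI Gc.
  have : \forall y \near c, `|G c - G y| < 1 / 4.
    by have /cvgrPdist_lt := cG c; apply; lra.
  move=> /nbhs_ballP[r /= r0 Hr]; exists c, r; split=> //.
  move=> y yc; rewrite chi0 ?mulr0//.
  have : `|G c - G y| < 1 / 4 by apply: Hr; rewrite -ball_normE/= distrC.
  by rewrite Gc ltr_norml; lra.
- move=> x; have DE : is_derive x 1 (fun x => m * chi (G x) : R^o) (m * ('D_1 chi (G x) * dG x)).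
    have dc : differentiable chi (G x) by exact: (Ck_R_differentiable _ (chik 1%N)).
    have dg : differentiable G x by exact: (Ck_R_differentiable _ (Gk 1%N)).
    have H : is_derive x 1 (chi \o G) ('D_1 chi (G x) * dG x).
      split; last by rewrite (derive_comp_R dg dc) (@derive_val _ _ _ _ _ _ _ (GE x)).
      exact/derivable1_diffP/differentiable_comp.
    exact: (is_deriveZ m H).
  rewrite (@derive_val _ _ _ _ _ _ _ DE); split.
    rewrite normrM (gtr0_norm m0) normrM.
    (* The height [m] was chosen to make this product of bounds exactly [K]. *)
    have -> : K = m * (D * (C / (n%:R * h))).
      by rewrite /m; field; rewrite !gt_eqF.
    by rewrite ler_wpM2l ?(ltW m0)// ler_pM.
  move=> Dn0; have /dG_V[i [gi xi _]] : dG x != 0.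
    by apply: contraNneq Dn0 => ->; rewrite [_ * 0]mulr0 mulr0.
  apply: (goodV i) => //; move: xi; rewrite hb => /andP[xi0 xi1].
  move: xi0 xi1; rewrite pmulr_lgt0 ?invr_gt0// ltr_pdivrMr// mul1r.
  by rewrite -natr1 mulrDl mul1r; lra.
Qed.

End Plateau.

(** * Charts at the points of a thickening *)

Section Charts.
Context (R : realType) (n : nat).

Lemma cinv_continuous (T : topologicalType) (c : chart R n T) (x : T) :
  is_chart c -> cdom c x -> nbhs (c x) (cimg c) -> cinv c y @[y --> c x] --> x.
Proof.
move=> [oc _ cK _ cc] cx ncx; have e : cinv c (c x) = x by rewrite cK// inE.
have := (subspace_continuousP _ _).1 cc (c x) (imageP _ cx).
by rewrite [X in _ --> X]e within_interior.
Qed.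

Lemma cimg_nbhs (T : topologicalType) (c : chart R n T) (x : T) (A : set T) :
  is_chart c -> cdom c x -> nbhs (c x) (cimg c) -> nbhs x A ->
  nbhs (c x) (c @` (cdom c `&` A)).
Proof.
move=> cc cx ncx nA.
have /(_ _ nA) := cinv_continuous cc cx ncx.
rewrite /= nbhs_simpl/= => nA'; apply: filterS (filterI ncx nA') => y [[z cz <-]] /=.
by case: cc => _ _ cK _ _; rewrite cK ?inE// => Az; exists z.
Qed.

Lemma cmap_continuous (T : topologicalType) (c : chart R n T) (x : T) :
  is_chart c -> cdom c x -> {for x, continuous c}.
Proof. by case=> _ _ _ + _ cx; apply; rewrite inE. Qed.

Lemma within_id T (F : set_system T) (D : set T) : Filter F -> F D ->
  within D F = F.
Proof.
move=> FF FD; apply/seteqP; split=> A; rewrite /within /=.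
  by move=> FA; apply: filterS (filterI FD FA) => x [Dx]; apply.
by apply: filterS => x Ax _.
Qed.

Lemma derive_in_nbhs (E F : normedModType R) (A : set E) (f : E -> F) (x v : E) :
  nbhs x A -> derive_in A f x v = 'D_v f x.
Proof.
move=> nA; rewrite /derive_in /derive within_id//.
have cl : (fun h : R => h *: v + x) @ (0 : R) --> x.
  rewrite -[X in _ --> X]add0r -[X in _ --> X + _](scale0r v).
  by apply: cvgD; [exact: scalel_continuous|exact: cvg_cst].
by apply: nbhs_dnbhs; exact: (cl _ nA).
Qed.

Lemma derive_comp (E F G : normedModType R) (f : E -> F) (g : F -> G) (x v : E) :
  differentiable f x -> differentiable g (f x) ->
  'D_v (g \o f) x = 'D_('D_v f x) g (f x).
Proof.
move=> df dg; rewrite deriveE; last exact: differentiable_comp.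
by rewrite diff_comp//= (deriveE _ dg) (deriveE _ df).
Qed.

Lemma smooth_on_derive_extension (E F : normedModType R) (A : set E) (f : E -> F) x :
  smooth_on A f -> A x -> exists (W : set E) (g : E -> F),
    [/\ open W, W x, forall k, Ck k W g & forall y, A y -> W y -> g y = f y].
Proof.
move=> sf /sf[W [g [oW Wx gk fg]]]; exists W, g; split=> // y Ay Wy.
by rewrite fg//; exact: mem_set.
Qed.

End Charts.

(** * The image of a thickening is interior, and its level parameter is regular *)

Section Thickening.
Context (R : realType) (n : nat) (M : manifold R n) (S : set M) (I : set R)
  (U : set M) (psi : M -> R -> M) (rho : M -> M) (tau : M -> R).
Hypotheses (hS : hypersurface S) (hpsi : thickening S I U psi).
Hypotheses (rhoC : smooth_map U rho) (tauC : smooth_from U (tau : _ -> R^o)).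
Hypothesis inv_psi : forall x t, S x -> I t ->
  rho (psi x t) = x /\ tau (psi x t) = t.

Let sl (z : 'rV[R]_n.+1) : 'rV[R]_n.+1 := \row_j (if j == ord0 then 0 else z 0 j).

Let sl_linear : linear sl.
Proof.
move=> a u v; apply/rowP => j; rewrite !mxE.
by case: ifP => _; rewrite ?mulr0 ?addr0.
Qed.

Let sl_continuous : continuous sl.
Proof.
move=> z; apply/continuous_mxP => i j; rewrite (ord1 i).
have -> : (fun y => sl y 0 j) = if j == ord0 then cst 0 else (fun y => y 0 j).
  by apply/funext => y; rewrite mxE; case: ifP.
by case: ifP => _; [exact: cst_continuous|exact: coord_continuous].
Qed.

Let slM := GRing.isLinear.Build _ _ _ _ _ sl_linear.
Let slL : {linear _ -> _} := HB.pack sl slM.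

Let sl_diff z : is_diff z sl sl.
Proof.
split; first exact: (@linear_differentiable _ _ _ slL z sl_continuous).
exact: (@diff_lin _ _ _ slL z sl_continuous).
Qed.

Let S_boundary x : S x -> exists2 d, slice_chart S d & cdom d x.
Proof. by case: hS => _ + _ _ _; apply. Qed.

Let A (d : chart R n M) := [set z | cimg d (sl z) /\ I (z 0 0)].
Let Psi (d : chart R n M) z := psi (cinv d (sl z)) (z 0 0).

Let A_open d : slice_chart S d -> open (A d).
Proof.
case: hpsi => [[oI _] _ _ _ _] [_ od _].
apply: openI; first by apply: open_comp => // z _; exact: sl_continuous.
by apply: open_comp => // z _; exact: coord_continuous.
Qed.

Let cinv_S d z : slice_chart S d -> cimg d (sl z) ->
  [/\ S (cinv d (sl z)), cdom d (cinv d (sl z)) & d (cinv d (sl z)) = sl z].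
Proof.
move=> [[[_ _ dK _ _] _] _ dS] [q dq qz].
have qE : cinv d (sl z) = q by rewrite -qz dK// inE.
split; rewrite qE//; apply/dS => //.
by rewrite qz mxE eqxx.
Qed.

Let Psi_spec d z : slice_chart S d -> A d z ->
  [/\ U (Psi d z), rho (Psi d z) = cinv d (sl z) & tau (Psi d z) = z 0 0].
Proof.
move=> sd [dz Iz]; have [Sq _ _] := cinv_S sd dz.
have [_ [_ UE] _ _ _] := hpsi.
have [rE tE] := inv_psi Sq Iz; split=> //.
by rewrite -UE; exists (cinv d (sl z)) => //; exists (z 0 0).
Qed.

(** Slot 0 of a slice chart vanishes on [S], so putting [t] there gives the coordinates of the pair
    [(y, t)]. *)
Let chart_coord d y t : slice_chart S d -> S y -> cdom d y -> I t ->
  let z := d y + t *: delta_mx 0 0 in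
  [/\ sl z = d y, z 0 0 = t, A d z & Psi d z = psi y t].
Proof.
move=> [[[_ _ dK _ _] _] _ dS] Sy dy It z.
have d0 : d y 0 0 = 0 by apply/dS.
have z0 : z 0 0 = t by rewrite !mxE d0 add0r mulr1.
have slz : sl z = d y.
  by apply/rowP => j; rewrite !mxE; case: eqVneq => [->|j0] //=; rewrite mulr0 addr0.
split=> //; first by split; rewrite ?slz ?z0//; exists y.
by rewrite /Psi slz z0 dK// inE.
Qed.

Let Psi_cont d z : slice_chart S d -> A d z -> {for z, continuous (Psi d)}.
Proof.
move=> sd Az; have [_ _ /(_ d sd)[+ _] _ _] := hpsi.
by rewrite continuous_open_subspace; [apply; rewrite inE|exact: A_open].
Qed.

(** [F] is psi read in charts. Its differential is injective because [rho] and [tau] form a smooth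
    left inverse, to which the chain rule is applied. *)
Lemma thickening_local_param x c : U x -> atlas c -> cdom c x ->
  exists (F : 'rV[R]_n.+1 -> 'rV[R]_n.+1) z0,
    [/\ F z0 = c x, differentiable F z0,
        (exists W, [/\ open W, W z0 & Ck 1 W F]),
        (\forall z \near z0, exists q, [/\ cdom c q, U q, F z = c q & tau q = z 0 0]) &
        forall v, 'd F z0 v = 0 -> v = 0].
Proof.
move=> Ux ca cx; have [[oI _] [oU UE] Psi_sm _ _] := hpsi.
have [y Sy [t It yt]] : [set psi x t | x in S & t in I] x by rewrite UE.
have [d sd dy] := S_boundary Sy.
have [slz z0t Az0 Psiz0] := chart_coord sd Sy dy It.
set z0 := d y + t *: delta_mx 0 0 in slz z0t Az0 Psiz0.
have cc := atlas_chart ca.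
pose F := c \o Psi d.
pose B := A d `&` Psi d @^-1` cdom c.
have oB : open B.
  have [ocd _ _ _ _] := cc.
  apply: (continuous_inP _ (A_open sd)).1 ocd => z /set_mem Az.
  exact: (Psi_cont sd Az).
have Bz0 : B z0 by split=> //=; rewrite Psiz0 yt.
have FB k : Ck k B F.
  by apply: smooth_on_Ck => //; have [_] := Psi_sm d sd; apply.
have dF : differentiable F z0 by exact: (Ck_differentiable oB (FB 1%N)).
exists F, z0; split=> //.
- by rewrite /F/= Psiz0 yt.
- by exists B.
- apply: filterS (open_nbhs_nbhs (conj oB Bz0)) => z [Az cz].
  by have [Uz _ tz] := Psi_spec sd Az; exists (Psi d z).
move=> v dv.
have [e ea ey] := atlas_cover y.
have ec := atlas_chart ea.
have rx : rho x = y by rewrite -yt; case: (inv_psi Sy It).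
have cK q : cdom c q -> cinv c (c q) = q.
  by case: cc => _ _ cK _ _ cq; rewrite cK// inE.
(* r followed by s reads rho in the charts c and d, through an atlas chart e around
   y since rho is only known to be smooth there; g reads tau. *)
have [Wr [r [oWr Wrx rk rE]]] : exists (Wr : set 'rV[R]_n.+1) (r : 'rV[R]_n.+1 -> 'rV[R]_n.+1),
    [/\ open Wr, Wr (c x), forall k, Ck k Wr r &
      forall q, cdom c q -> U q -> cdom e (rho q) -> Wr (c q) -> r (c q) = e (rho q)].
  have [_ /(_ e ea) sr] := rhoC ca.
  have [|W [g [oW Wx gk gE]]] := smooth_on_derive_extension sr (x := c x).
    by split; [exists x|rewrite /= cK// rx].
  exists W, g; split=> // q cq Uq eq Wq; rewrite gE//=; first by rewrite cK.
  by split; [exists q|rewrite /= cK].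
have [Wt [g [oWt Wtx gk gE]]] : exists (Wt : set 'rV[R]_n.+1) (g : 'rV[R]_n.+1 -> R^o),
    [/\ open Wt, Wt (c x), forall k, Ck k Wt g &
      forall q, cdom c q -> U q -> Wt (c q) -> g (c q) = tau q].
  have [|W [g [oW Wx gk gE]]] := smooth_on_derive_extension (tauC ca) (x := c x).
    by exists x.
  exists W, g; split=> // q cq Uq Wq; rewrite gE//=; first by rewrite cK.
  by exists q.
have [Ws [s [oWs Wsx sk sE]]] : exists (Ws : set 'rV[R]_n.+1) (s : 'rV[R]_n.+1 -> 'rV[R]_n.+1),
    [/\ open Ws, Ws (e y), forall k, Ck k Ws s &
      forall q, cdom d q -> cdom e q -> Ws (e q) -> s (e q) = d q].
  have [[_ /(_ e ea)[_ sr]] _ _] := sd.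
  have [|W [s [oW Wx sk sE]]] := smooth_on_derive_extension sr (x := e y).
    by exists y.
  have [_ _ eK _ _] := ec.
  exists W, s; split=> // q dq eq Wq; rewrite sE//=; first by rewrite eK// inE.
  by exists q.
have Fz0 : F z0 = c x by rewrite /F/= Psiz0 yt.
have rcx : r (c x) = e y by rewrite rE ?rx.
have dr : differentiable r (F z0) by rewrite Fz0; exact: (Ck_differentiable oWr (rk 1%N)).
have ds : differentiable s ((r \o F) z0).
  by rewrite /= Fz0 rcx; exact: (Ck_differentiable oWs (sk 1%N)).
have dg : differentiable g (F z0) by rewrite Fz0; exact: (C1_differentiable oWt (gk 1%N)).
have near_pt (P : set M) : nbhs (psi y t) P -> \forall z \near z0, P (Psi d z).
  by rewrite -Psiz0 => nP; have /(_ _ nP) := Psi_cont sd Az0.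
have nB : \forall z \near z0, B z by exact: open_nbhs_nbhs.
have cF : {for z0, continuous F} by exact: differentiable_continuous.
have nWr : \forall z \near z0, Wr (F z).
  by apply: cF; rewrite Fz0; exact: open_nbhs_nbhs.
have nWt : \forall z \near z0, Wt (F z).
  by apply: cF; rewrite Fz0; exact: open_nbhs_nbhs.
have od : open (cimg d) by case: sd.
have dc : is_chart d by case: sd => -[].
have cq : cinv d (sl z) @[z --> z0] --> y.
  have nd : nbhs (d y) (cimg d) by apply: open_nbhs_nbhs; split=> //; exists y.
  have := cinv_continuous dc dy nd; rewrite -slz => H.
  by apply: cvg_comp H; exact: sl_continuous.
have ne : \forall z \near z0, cdom e (cinv d (sl z)).
  by apply: cq; apply: open_nbhs_nbhs; split=> //; case: ec.
have nWs : \forall z \near z0, Ws (e (cinv d (sl z))).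
  have : e (cinv d (sl z)) @[z --> z0] --> e y.
    by apply: cvg_comp cq _; exact: cmap_continuous.
  by apply; exact: open_nbhs_nbhs.
(* The two halves of the left inverse: [rho] recovers every slot but 0, and [tau] recovers slot
   0. *)
have eq1 : \forall z \near z0, (s \o (r \o F)) z = sl z.
  near=> z; have [Az cz] : B z by near: z.
  have [Uz rz tz] := Psi_spec sd Az; have [_ dq dqE] := cinv_S sd Az.1.
  have ez : cdom e (cinv d (sl z)) by near: z.
  rewrite /= rE// ?rz//; last by near: z.
  by rewrite sE//; near: z.
have eq2 : \forall z \near z0, (g \o F) z = z 0 0.
  near=> z; have [Az cz] : B z by near: z.
  have [Uz rz tz] := Psi_spec sd Az.
  by rewrite /= gE//; near: z.
have dv' : 'D_v F z0 = 0 by rewrite deriveE.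
have drF : differentiable (r \o F) z0 by exact: differentiable_comp.
have slv : sl v = 0.
  have E1 : 'D_v sl z0 = sl v.
    by rewrite deriveE ?(@diff_val _ _ _ _ _ _ _ (sl_diff z0))//; case: (sl_diff z0).
  have E2 := near_eq_derive v eq1.
  have E3 := derive_comp v drF ds.
  have E4 := derive_comp v dF dr.
  by rewrite -E1 -E2 E3 E4 dv' !derive0.
have v00 : v 0 0 = 0.
  have [_ <-] := (is_derive_mxP id z0 v v).1 (is_derive_id z0 v) 0 0.
  have E2 := near_eq_derive (W := R^o) v eq2.
  have E3 := derive_comp v dF dg.
  by rewrite -[LHS]E2 E3 dv' derive0.
apply/rowP => j; have := congr1 (fun u : 'rV_n.+1 => u 0 j) slv.
by rewrite !mxE; case: eqVneq => [->|].
Unshelve. all: by end_near. Qed.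

(** This places [U] in the interior of [M], which is assumed of [S] only. From here on, derivatives
    at points of [U] are two-sided. *)
Lemma thickening_nbhs_cimg x c : U x -> atlas c -> cdom c x ->
  nbhs (c x) (cimg c).
Proof.
move=> Ux ca cx.
have [F [z0 [Fz0 dF [W [oW Wz0 FW]] nF Finj]]] := thickening_local_param Ux ca cx.
have cc := atlas_chart ca; have [_ [oc|[V oV cV]] _ _ _] := cc.
  by apply: open_nbhs_nbhs; split=> //; exists x.
have [Vx hx] : (V `&` half_space (R := R) (n := n)) (c x).
  by rewrite -cV; exists x.
have [x00|x0] := eqVneq (c x 0 0) 0; last first.
  have x0' : 0 < c x 0 0 by rewrite lt_neqAle eq_sym x0.
  rewrite cV; apply: filterI; first exact: open_nbhs_nbhs.
  have h : (fun y : 'rV[R]_n.+1 => y 0 0) @ (c x) --> c x 0 0.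
    exact: coord_continuous.
  have nx : \forall t \near c x 0 0, 0 < t by exact: lt_nbhsr.
  by apply: (@filterS _ (nbhs (c x)) _ _ _ _ (h _ nx)) => y /ltW.
exfalso.
(* The first coordinate of F would be minimal at z0, and the differential of F
   would not be onto. *)
have F00 v : ('d F z0 v) 0 0 = 0.
  rewrite -deriveE//.
  have dFv : is_derive z0 v F ('D_v F z0) by apply: derivableP; exact: diff_derivable.
  have [_ <-] := (is_derive_mxP F z0 v _).1 dFv 0 0.
  have nW : \forall z \near z0, W z by exact: open_nbhs_nbhs.
  have [r /= r0 Br] := (nbhs_ballP _ _).1 (filterI nW nF).
  have [e e0 eP] : exists2 e : R, 0 < e & forall t, `|t| < e -> ball z0 r (t *: v + z0).
    exists (r / (`|v| + 1)); first by rewrite divr_gt0// ltr_wpDl.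
    move=> t te; rewrite -ball_normE/= opprD addrCA subrr addr0 normrN normrZ.
    have v1 : 0 < `|v| + 1 by rewrite ltr_wpDl.
    apply: (@le_lt_trans _ _ (`|t| * (`|v| + 1))); first by rewrite ler_wpM2l// lerDl.
    by rewrite -ltr_pdivlMr.
  pose f (t : R) : R := F (t *: v + z0) 0 0.
  have df (t : R) : `|t| < e -> is_derive t 1 f ('D_v (fun z => F z 0 0 : R) (t *: v + z0)).
    move=> /eP/Br[Wt _]; apply: (@is_derive_line _ _ _ (fun z => F z 0 0)).
    have d1 : derivable F (t *: v + z0) v by exact: (Ck_derivable FW).
    by apply: derivableP; exact: (derivable_mxP _ _ _).1.
  have eN0 : - e < 0 by rewrite oppr_lt0.
  have itv t : t \in `]- e, e[%R -> `|t| < e by rewrite in_itv/= ltr_norml.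
  have := @derive1_at_min R f (- e) e 0 (ltW (lt_trans eN0 e0)).
  have z0I : 0 \in `](- e), e[%R by rewrite in_itv/= eN0.
  move=> /(_ (fun t te => @ex_derive _ _ _ _ _ _ _ (df t (itv t te))) z0I) [].
    move=> t /itv/eP/Br[_ [q [cq _ Fq _]]].
    rewrite /f scale0r add0r Fz0 x00 Fq.
    suff : half_space (c q) by [].
    by have [] : (V `&` half_space (R := R) (n := n)) (c q) by rewrite -cV; exists q.
  have e0' : `|0 : R| < e by rewrite normr0.
  by move=> _; rewrite (@derive_val _ _ _ _ _ _ _ (df 0 e0')) scale0r add0r.
(* [J] acts on row vectors from the right: injectivity makes it invertible, whereas [F00] says that
   its column 0 vanishes. *)
pose J := lin1_mx ('d F z0).
have JE v : v *m J = 'd F z0 v by rewrite mul_rV_lin1.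
have Ju : J \in unitmx.
  rewrite -row_free_unit -kermx_eq0; apply/rowV0P => v /sub_kermxP.
  by rewrite JE => /Finj.
have : J *m (delta_mx 0 0 : 'cV[R]_n.+1) = 0.
  apply/colP => i; rewrite -colE !mxE -[RHS](F00 (delta_mx 0 i)) -JE.
  by rewrite -rowE !mxE.
move=> /(congr1 (mulmx (invmx J))); rewrite mulKmx// mulmx0.
by move=> /colP/(_ 0)/eqP; rewrite !mxE eqxx oner_eq0.
Qed.

(** Since tau (psi x t) = t, moving along the parameter axis changes [tau] at unit speed. This will
    show that the Hamiltonian field has no zero. *)
Lemma thickening_derive_tau x c : U x -> atlas c -> cdom c x ->
  exists v, 'D_v (tau \o cinv c : _ -> R^o) (c x) = 1.
Proof.
move=> Ux ca cx.
have [F [z0 [Fz0 dF _ nF _]]] := thickening_local_param Ux ca cx.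
have cc := atlas_chart ca; have [_ _ cK _ _] := cc.
have oU : open U by case: hpsi => _ [].
have nU : nbhs (c x) (c @` (cdom c `&` U)).
  apply: cimg_nbhs => //; first exact: thickening_nbhs_cimg.
  exact: open_nbhs_nbhs.
have dt : differentiable (tau \o cinv c : _ -> R^o) (F z0).
  have [W [oW Wx] WU] : exists2 W, open_nbhs (c x) W & W `<=` c @` (cdom c `&` U).
    by move: nU; rewrite nbhsE.
  rewrite Fz0.
  have Wt : Ck 1 W (tau \o cinv c : _ -> R^o).
    by apply: smooth_on_Ck => //; apply: smooth_on_sub WU _; exact: tauC.
  exact: (C1_differentiable oW Wt).
exists ('D_(delta_mx 0 0) F z0).
have [_ E1] := (is_derive_mxP id z0 (delta_mx 0 0) _).1 (is_derive_id z0 (delta_mx 0 0)) 0 0.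
have <- : (delta_mx 0 0 : 'rV[R]_n.+1) 0 0 = 1 by rewrite !mxE eqxx.
rewrite -E1 -Fz0 -(derive_comp _ dF dt); apply: (near_eq_derive (W := R^o)).
by apply: filterS nF => z [q [cq _ Fq <-]]; rewrite /= Fq cK// inE.
Qed.

(** The image of a compact product. The thickening is continuous in coordinates by definition; joint
    continuity in the point of [S] and the parameter is recovered from this in a slice chart around
    each point. *)
Lemma compact_slab a b : (forall t, a <= t <= b -> I t) ->
  compact [set psi x t | x in S & t in `[a, b]].
Proof.
move=> abI; have cS : compact S by case: hS.
have -> : [set psi x t | x in S & t in `[a, b]] =
    (fun p : M * R => psi p.1 p.2) @` (S `*` `[a, b]).
  apply/seteqP; split=> [_ [x Sx [t t01 <-]]|_ [[x t] [Sx tI] <-]].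
    by exists (x, t).
  by exists x => //; exists t.
apply: continuous_compact; last exact: compact_setX cS (@segment_compact _ _ _).
apply/subspace_continuousP => -[x t] [/= Sx]; rewrite in_itv/= => /abI It.
have [d sd dx] := S_boundary Sx.
have [slz zt Az Pz] := chart_coord sd Sx dx It.
set z := d x + t *: delta_mx 0 0 in slz zt Az Pz.
pose Z (p : M * R) := d p.1 + p.2 *: delta_mx 0 0 : 'rV[R]_n.+1.
have od : open (cdom d) by case: sd => -[[]].
have Zc : Z @ (x, t) --> z.
  apply: cvgD; last by apply: cvgZ; [exact: cvg_snd|exact: cvg_cst].
  apply: cvg_comp; first exact: cvg_fst.
  by apply: cmap_continuous => //; case: sd => -[].
have PZ : Psi d (Z p) @[p --> (x, t)] --> psi x t.
  by rewrite -Pz; apply: cvg_comp Zc _; exact: Psi_cont.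
apply: cvg_trans (cvg_trans (cvg_app _ (@cvg_within _ _ _ _)) PZ).
apply: near_eq_cvg; rewrite near_withinE.
have nd : \forall p \near (x, t), cdom d p.1.
  by apply: (@cvg_fst _ _ (nbhs x) (nbhs t)); exact: open_nbhs_nbhs.
apply: filterS nd => -[y s] /= dy [/= Sy]; rewrite in_itv/= => /abI Is.
by have [] := chart_coord sd Sy dy Is.
Qed.

End Thickening.

(** * The Hamiltonian field of the level parameter *)

Section HamiltonianField.
Context (R : realType) (n : nat) (M : manifold R n) (w : M -> 'M[R]_n.+1)
  (U : set M) (tau : M -> R).
Hypotheses (hw : symplectic w) (oU : open U).
Hypothesis U_interior : forall x c, U x -> atlas c -> cdom c x ->
  nbhs (c x) (cimg c).
Hypothesis tauC : smooth_from U (tau : _ -> R^o).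
Implicit Types (c : chart R n M) (x : M).

Definition chart_dom (V : set M) c : set 'rV[R]_n.+1 := c @` (cdom c `&` V).

Lemma chart_atP x : atlas (chart_at x) /\ cdom (chart_at x) x.
Proof. by rewrite /chart_at; case: cid2. Qed.

Lemma atlas_cinvK c x : atlas c -> cdom c x -> cinv c (c x) = x.
Proof. by move=> /atlas_chart[_ _ cK _ _] cx; rewrite cK// inE. Qed.

Lemma chart_dom_open c : atlas c -> open (chart_dom U c).
Proof.
move=> ca; rewrite openE => _ [x [cx Ux] <-].
apply: (cimg_nbhs (atlas_chart ca)) => //; first exact: U_interior.
exact: open_nbhs_nbhs.
Qed.

Definition jac c c' x := 'J (c' \o cinv c) (c x).

Lemma cdom_nbhs c x : atlas c -> cdom c x -> nbhs x (cdom c).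
Proof.
by move=> /atlas_chart[oc _ _ _ _] cx; apply: open_nbhs_nbhs.
Qed.

Lemma trans_differentiable c c' x : atlas c -> atlas c' -> U x ->
  cdom c x -> cdom c' x -> differentiable (c' \o cinv c) (c x).
Proof.
move=> ca ca' Ux cx cx'.
have nW : nbhs (c x) (c @` (cdom c `&` cdom c')).
  apply: (cimg_nbhs (atlas_chart ca)) => //; first exact: U_interior.
  exact: cdom_nbhs.
have [W [oW Wx] WU] : exists2 W, open_nbhs (c x) W & W `<=` c @` (cdom c `&` cdom c').
  by move: nW; rewrite nbhsE.
apply: (@Ck_differentiable _ 0 _ W) => //.
apply: smooth_on_Ck => //; apply: smooth_on_sub WU _.
by case: (atlas_compatible ca ca').
Qed.

Lemma derive_trans c c' x v : atlas c -> atlas c' -> U x ->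
  cdom c x -> cdom c' x -> 'D_v (c' \o cinv c) (c x) = v *m jac c c' x.
Proof.
by move=> *; rewrite deriveEjacobian//; exact: trans_differentiable.
Qed.

Lemma near_cinvK c x : atlas c -> U x -> cdom c x ->
  \forall y \near c x, cdom c (cinv c y) /\ c (cinv c y) = y.
Proof.
move=> ca Ux cx; apply: filterS (U_interior Ux ca cx) => _ [q cq <-].
by rewrite atlas_cinvK.
Qed.

Lemma near_cinv c x (P : set M) : atlas c -> U x -> cdom c x -> nbhs x P ->
  \forall y \near c x, P (cinv c y).
Proof.
move=> ca Ux cx nP.
exact: (cinv_continuous (atlas_chart ca) cx (U_interior Ux ca cx) nP).
Qed.

Lemma jacV c c' x : atlas c -> atlas c' -> U x -> cdom c x -> cdom c' x ->
  jac c c' x *m jac c' c x = 1%:M.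
Proof.
move=> ca ca' Ux cx cx'; apply/row_matrixP => i; rewrite !rowE mulmx1 mulmxA.
rewrite -(derive_trans _ ca' ca Ux cx' cx) -(derive_trans _ ca ca' Ux cx cx').
have e : (c' \o cinv c) (c x) = c' x by rewrite /= atlas_cinvK.
rewrite -e -derive_comp; last 2 first.
- exact: trans_differentiable.
- by rewrite e; exact: trans_differentiable.
rewrite -[RHS](derive_id (c x)); apply: near_eq_derive.
have n1 := near_cinvK ca Ux cx.
have n2 : \forall y \near c x, cdom c' (cinv c y).
  by apply: near_cinv => //; exact: cdom_nbhs.
near=> y; rewrite /= atlas_cinvK//; last by near: y.
suff [] : cdom c (cinv c y) /\ c (cinv c y) = y by [].
by near: y.
Unshelve. all: by end_near. Qed.

(** Passes from coordinates in [c] to those in [chart_at x], in which tangent vectors and the form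
    are recorded. *)
Let J c x := jac c (chart_at x) x.

Lemma jac_unit c x : atlas c -> U x -> cdom c x -> J c x \in unitmx.
Proof.
move=> ca Ux cx; have [ca' cx'] := chart_atP x.
have JV := jacV ca ca' Ux cx cx'.
have [Ju _] := mulmx1_unit JV.
exact: Ju.
Qed.

Definition tau_grad c (y : 'rV[R]_n.+1) : 'rV[R]_n.+1 :=
  \row_i 'D_(delta_mx 0 i) (tau \o cinv c : _ -> R^o) y.

Lemma tau_Ck c k : atlas c -> Ck k (chart_dom U c) (tau \o cinv c : _ -> R^o).
Proof.
by move=> ca; apply: smooth_on_Ck; [exact: chart_dom_open|exact: tauC].
Qed.

Lemma tau_differentiable c x : atlas c -> U x -> cdom c x ->
  differentiable (tau \o cinv c : _ -> R^o) (c x).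
Proof.
move=> ca Ux cx; apply: (C1_differentiable (chart_dom_open ca) (tau_Ck 1 ca)).
by exists x.
Qed.

Lemma derive_tau c x v : atlas c -> U x -> cdom c x ->
  'D_v (tau \o cinv c : _ -> R^o) (c x) = (tau_grad c (c x) *m v^T) 0 0.
Proof.
move=> ca Ux cx; have dt := tau_differentiable ca Ux cx.
rewrite deriveE// diff_row_sum// mxE; apply: eq_bigr => i _.
by rewrite !mxE [LHS]mulrC.
Qed.

Lemma tau_grad_chart c x : atlas c -> U x -> cdom c x ->
  tau_grad c (c x) = tau_grad (chart_at x) (chart_at x x) *m (J c x)^T.
Proof.
move=> ca Ux cx; have [ca' cx'] := chart_atP x.
apply/rowP => i; rewrite mxE.
set c' := chart_at x in ca' cx' *.
have e : (c' \o cinv c) (c x) = c' x by rewrite /= atlas_cinvK.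
have E1 : 'D_(delta_mx 0 i) (tau \o cinv c : _ -> R^o) (c x) =
    'D_(delta_mx 0 i) ((tau \o cinv c') \o (c' \o cinv c) : _ -> R^o) (c x).
  apply: (near_eq_derive (W := R^o)).
  have n2 : \forall y \near c x, cdom c' (cinv c y).
    by apply: near_cinv => //; exact: cdom_nbhs.
  by apply: filterS n2 => y cy /=; rewrite atlas_cinvK.
have dt : differentiable (tau \o cinv c' : _ -> R^o) ((c' \o cinv c) (c x)).
  by rewrite e; exact: tau_differentiable.
have E2 := derive_comp (delta_mx 0 i) (trans_differentiable ca ca' Ux cx cx') dt.
rewrite E1 [LHS]E2 e derive_trans// derive_tau// -rowE !mxE; apply: eq_bigr => j _.
by rewrite !mxE.
Qed.

Lemma form_unit x : w x \in unitmx.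
Proof.
rewrite -row_free_unit -kermx_eq0; apply/rowV0P => v /sub_kermxP vw.
case: hw => _ _ _ nd; apply: (nd x) => u.
by rewrite /pairing vw mul0mx mxE.
Qed.

Lemma form_coordE c x : atlas c -> U x -> cdom c x ->
  form_coord w c (c x) = J c x *m w x *m (J c x)^T.
Proof.
move=> ca Ux cx; have [ca' cx'] := chart_atP x.
have cvE v : chart_vector c (c x) v = v *m J c x.
  rewrite /chart_vector derive_in_nbhs; last exact: U_interior.
  by rewrite atlas_cinvK// derive_trans.
apply/matrixP => i j; rewrite mxE /pairing !cvE atlas_cinvK//.
pose N := J c x *m w x *m (J c x)^T; rewrite -/N.
have NE (u v : 'rV[R]_n.+1) : u *m J c x *m w x *m (v *m J c x)^T = u *m N *m v^T.
  by rewrite /N trmx_mul !mulmxA.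
rewrite NE.
by rewrite trmx_delta -rowE -colE !mxE.
Qed.

(* In row-vector coordinates, omega(X, .) = - d tau reads X *m F = - grad tau,
   where F is the matrix of the form in the chart. *)
Definition field_coord c (y : 'rV[R]_n.+1) : 'rV[R]_n.+1 :=
  - (tau_grad c y) *m invmx (form_coord w c y).

(** These coordinates may jump with [x], since the chosen chart does; smoothness is therefore
    expressed by [field_coord]. *)
Definition ham_field x : 'rV[R]_n.+1 :=
  - (tau_grad (chart_at x) (chart_at x x)) *m invmx (w x).

Lemma form_coord_unit c x : atlas c -> U x -> cdom c x ->
  form_coord w c (c x) \in unitmx.
Proof.
move=> ca Ux cx; rewrite form_coordE// !unitmx_mul form_unit unitmx_tr.
by rewrite jac_unit.
Qed.

Lemma field_coordE c x : atlas c -> U x -> cdom c x ->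
  field_coord c (c x) *m J c x = ham_field x.
Proof.
move=> ca Ux cx; have Ju := jac_unit ca Ux cx; have wu := form_unit x.
have Fu := form_coord_unit ca Ux cx.
apply: (canRL (mulmxK wu)).
apply: (can_inj (mulmxK (_ : (J c x)^T \in unitmx))); first by rewrite unitmx_tr.
rewrite mulNmx -tau_grad_chart//.
have <- : field_coord c (c x) *m form_coord w c (c x) = - tau_grad c (c x).
  by rewrite /field_coord mulmxKV.
by rewrite form_coordE// !mulmxA.
Qed.

(** By Cramer's rule the entries of the inverse matrix are quotients of determinants with a
    nonvanishing denominator. *)
Lemma field_coord_Ck c k : atlas c -> Ck k (chart_dom U c) (field_coord c).
Proof.
move=> ca; have oW := chart_dom_open ca.
have Fk i j : Ck k (chart_dom U c) (fun y => form_coord w c y i j : R^o).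
  move: i j; apply: (Ck_mxP _ _ oW).1; apply: smooth_on_Ck => //.
  apply: (@smooth_on_sub _ _ _ (cimg c)); last by case: hw => + _ _ _; exact.
  by move=> _ [x [cx Ux] <-]; exists x.
have gk i : Ck k (chart_dom U c) (fun y => - tau_grad c y 0 i : R^o).
  apply: (@Ck_eq _ _ _ _ _ (cst (-1) \* ('D_(delta_mx 0 i) (tau \o cinv c : _ -> R^o)))) => //.
    by move=> y _; rewrite mxE /= mulN1r.
  apply: Ck_mul => //; first exact: Ck_cst.
  exact: (Ck_derive _ (tau_Ck k.+1 ca)).
have fu y : chart_dom U c y -> form_coord w c y \in unitmx.
  by move=> [x [cx Ux] <-]; exact: form_coord_unit.
apply/(Ck_mxP _ _ oW) => i j; rewrite (ord1 i).
apply: (@Ck_eq _ _ _ _ _ (fun y => \sum_l (- tau_grad c y 0 l) *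
   ((\det (form_coord w c y))^-1 * cofactor (form_coord w c y) j l) : R^o)) => //.
  move=> y /set_mem/fu Fu; rewrite mxE; apply: eq_bigr => l _.
  by rewrite /invmx Fu !mxE.
apply: Ck_sum => // l; apply: Ck_mul => //; apply: Ck_mul => //.
  apply: Ck_inv => //; last exact: Ck_det.
  by move=> y /fu; rewrite unitmxE unitfE.
apply: Ck_mul => //; first exact: Ck_cst.
apply: Ck_det => // a b; rewrite (_ : (fun y => _) =
  (fun y => form_coord w c y (lift j a) (lift l b) : R^o))//.
by apply/funext => y; rewrite !mxE.
Qed.

Lemma change_chart (g : R -> M) t u c c' : atlas c -> atlas c' -> U (g t) ->
  cdom c (g t) -> cdom c' (g t) -> {for t, continuous g} ->
  is_derive t 1 (c \o g) u -> is_derive t 1 (c' \o g) (u *m jac c c' (g t)).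
Proof.
move=> ca ca' Ut ct ct' cg dg.
have dtr := trans_differentiable ca ca' Ut ct ct'.
rewrite -derive_trans// deriveE//.
apply: (near_eq_is_derive (f := (c' \o cinv c) \o (c \o g))).
  have : \forall s \near t, cdom c (g s) by apply: cg; exact: cdom_nbhs.
  by apply: filterS => s cs /=; rewrite atlas_cinvK.
exact: is_derive_comp_curve.
Qed.

Definition flow_line (e : R) (g : R -> M) : Prop :=
  continuous g /\ forall t, [/\ U (g t), tau (g t) = e &
    is_derive t 1 (chart_at (g t) \o g) (ham_field (g t))].

Lemma chart_atE c (g : R -> M) t : atlas c -> U (g t) -> cdom c (g t) ->
  {for t, continuous g} ->
  is_derive t 1 (c \o g) (field_coord c (c (g t))) <->
  is_derive t 1 (chart_at (g t) \o g) (ham_field (g t)).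
Proof.
move=> ca Ut ct cg; have [ca' ct'] := chart_atP (g t); split=> dg.
  by rewrite -(field_coordE ca)//; exact: change_chart dg.
have := change_chart ca' ca Ut ct' ct cg dg.
by rewrite -(field_coordE ca Ut ct) -mulmxA jacV// mulmx1.
Qed.

Lemma flow_line_chart c e g t : flow_line e g -> atlas c -> cdom c (g t) ->
  is_derive t 1 (c \o g) (field_coord c (c (g t))).
Proof.
by move=> [cg og] ca ct; have [Ut _ dg] := og t; apply/(chart_atE ca Ut ct (cg t)).
Qed.

Lemma pairing_ham_field x v : U x ->
  pairing w x (ham_field x) v = - differential U tau x v.
Proof.
move=> Ux; have [ca cx] := chart_atP x.
rewrite /differential derive_in_nbhs; last first.
  apply: open_nbhs_nbhs; split; first exact: chart_dom_open.
  by exists x.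
rewrite derive_tau// /pairing /ham_field mulmxKV ?form_unit//.
by rewrite mulNmx mxE.
Qed.

End HamiltonianField.

(** * Limits of flow lines *)

Lemma ultra_fmap (T T' : Type) (f : T -> T') (F : set_system T) :
  UltraFilter F -> UltraFilter (f @ F).
Proof.
move=> UF; have PF : ProperFilter F by exact: ultra_proper.
apply: Build_UltraFilter => G PG FG; apply/seteqP; split => // B GB.
have [//|FnB] := in_ultra_setVsetC (f @^-1` B) UF.
have GnB : G (~` B) by exact: FG.
have PG0 : ProperFilter G := PG.
by have [x []] := filter_ex (filterI GB GnB).
Qed.

(** * A curve of bounded speed stays in a chart for a definite time *)

Section Trapping.
Context (R : realType) (n : nat) (M : manifold R n).
Implicit Types (c : chart R n M) (g : R -> M).

Let chart_ball c (a : 'rV[R]_n.+1) (r : R) : set M := cinv c @` closed_ball a r.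

(** A compact subset of a Hausdorff space. Being closed in [M], and not merely in the domain of the
    chart, it stops a curve from escaping through the edge of that domain. *)
Lemma chart_ball_closed c a r : atlas c -> 0 < r -> closed_ball a r `<=` cimg c ->
  closed (chart_ball c a r).
Proof.
move=> ca r0 aC; apply: (compact_closed (@manifold_hausdorff _ _ M)).
apply: continuous_compact.
  by apply: continuous_subspaceW aC _; have [] := atlas_chart ca.
apply: bounded_closed_compact; last exact: closed_ball_closed.
exists (`|a| + r); split; first exact: num_real.
move=> e e1 y; rewrite closed_ballE// /closed_ball_/= => ay.
rewrite -[y](subrK a) (le_trans (ler_normD _ _))// addrC.
by rewrite (le_trans _ (ltW e1))// lerD2l distrC.
Qed.

(** A first exit argument. The coordinate [c (g s)] carries no information outside [cdom c], so
    leaving the domain and leaving the ball are treated as one event. *)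
Lemma trapping_right c a r C g v t0 t1 : atlas c -> 0 < r -> 0 < C ->
  closed_ball a r `<=` cimg c -> continuous g ->
  (forall s, cdom c (g s) -> closed_ball a r (c (g s)) ->
     is_derive s 1 (c \o g) (v s) /\ `|v s| <= C) ->
  cdom c (g t0) -> `|c (g t0) - a| < r / 2 ->
  t0 <= t1 -> C * (t1 - t0) <= r / 4 ->
  cdom c (g t1) /\ `|c (g t1) - a| < r.
Proof.
move=> ca r0 C0 aC cg gv ct0 gt0 t01 t01r.
have cc := atlas_chart ca; have [oc _ cK _ _] := cc.
pose N := [set q : M | cdom c q /\ `|c q - a| < r].
have N_nbhs s : N (g s) -> \forall u \near s, N (g u).
  move=> [cs sa].
  have n1 : \forall u \near s, cdom c (g u) by apply: cg; exact: open_nbhs_nbhs.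
  have cgs : (c \o g) u @[u --> s] --> c (g s).
    by apply: continuous_comp; [exact: cg|exact: cmap_continuous].
  have n2 : \forall u \near s, `|c (g u) - a| < r.
    have H : (fun u => c (g u) - a) @ s --> c (g s) - a.
      by apply: cvgB cgs _; exact: cvg_cst.
    exact: (cvgr_norm_lt _ H r sa).
  by apply: filterS (filterI n1 n2).
suff all_N s : t0 <= s <= t1 -> N (g s) by apply: all_N; rewrite t01 lexx.
move=> /andP[t0s st1]; apply: contrapT => nNs.
pose B := [set u | t0 <= u /\ ~ N (g u)].
have Bs : B s by [].
have lB : lbound B t0 by move=> u [].
have hB : has_inf B by split; [exists s|exists t0].
set b := inf B.
have t0b : t0 <= b by apply: lb_le_inf => //; exists s.
have bs : b <= s by apply: ge_inf => //; exists t0.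
have lt_b u : t0 <= u < b -> N (g u).
  move=> /andP[t0u ub]; apply: contrapT => nN.
  by have : b <= u; [apply: ge_inf => //; exists t0|rewrite leNgt ub].
have nNb : ~ N (g b).
  move=> /N_nbhs/nbhs_ballP[e /= e0 eN].
  have [u [t0u nNu] ub] := inf_adherent e0 hB.
  have bu : b <= u by apply: ge_inf => //; exists t0.
  apply/nNu/eN; rewrite -ball_normE/= distrC ger0_norm ?subr_ge0//.
  by rewrite ltrBlDl.
have Nt0 : N (g t0) by split=> //; rewrite (lt_trans gt0)// ltr_pdivrMr// ltr_pMr// ltr1n.
have {}t0b : t0 < b by rewrite lt_neqAle t0b andbT; apply: contra_notN nNb => /eqP <-.
(* Before the first exit time [b] the mean value inequality keeps the curve within r/2 + r/4 of [a].
   As [Q] is closed in [M], this persists at [b], against [nNb]. *)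
pose Q := chart_ball c a (3 / 4 * r).
have r34 : 0 < 3 / 4 * r by rewrite mulr_gt0.
have sub34 : closed_ball a (3 / 4 * r) `<=` closed_ball a r.
  move=> y; rewrite !closed_ballE// /closed_ball_/= => /le_trans; apply.
  by move: r0; lra.
have QN q : Q q -> N q.
  move=> [y Dy <-]; have [z cz zy] : cimg c y by apply/aC/sub34.
  rewrite -zy cK ?inE//; split=> //; rewrite zy.
  move: Dy; rewrite closed_ballE// /closed_ball_/= distrC => /le_lt_trans; apply.
  by move: r0; lra.
have Q_lt u : t0 <= u < b -> Q (g u).
  move=> /andP[t0u ub].
  have NN x : t0 <= x <= u -> N (g x).
    by move=> /andP[? xu]; apply: lt_b; rewrite (le_lt_trans xu ub) andbT.
  have dN x : t0 <= x <= u -> is_derive x 1 (c \o g) (v x) /\ `|v x| <= C.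
    move=> /NN[cx xa]; apply: gv => //.
    by rewrite closed_ballE// /closed_ball_/= distrC ltW.
  have := @curve_mvt _ _ (c \o g) v t0 u C 0 t0u (ltW C0).
  move=> /(_ (fun x xI => (dN x xI).1)).
  have vC x : t0 <= x <= u -> `|v x - 0| <= C by rewrite subr0 => /dN[].
  move=> /(_ vC); rewrite scaler0 subr0 /= => gu.
  have [cu ua] := NN u (introT andP (conj t0u (lexx u))).
  exists (c (g u)); last by rewrite cK// inE.
  rewrite closed_ballE// /closed_ball_/= distrC.
  rewrite -[c (g u)](subrK (c (g t0))) -addrA (le_trans (ler_normD _ _))//.
  have ut1 : C * (u - t0) <= r / 4.
    apply: le_trans t01r; rewrite ler_wpM2l ?(ltW C0)// lerD2r.
    exact: le_trans (ltW ub) (le_trans bs st1).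
  have := le_trans gu ut1; move: gt0; lra.
apply/nNb/QN; apply: contrapT => nQ.
have cQ : closed Q by apply: chart_ball_closed => //; exact: subset_trans sub34 aC.
have nn : nbhs (g b) (~` Q).
  by apply: open_nbhs_nbhs; split=> //; exact: closed_openC.
have /nbhs_ballP[e /= e0 eQ] := cg b _ nn.
pose u := Num.max t0 (b - e / 2).
apply: (eQ u); last first.
  by apply: Q_lt; rewrite /u le_max lexx gt_max t0b/=; lra.
rewrite -ball_normE/= /u ltr_norml.
have : b - e / 2 <= Num.max t0 (b - e / 2) by rewrite le_max lexx orbT.
have : Num.max t0 (b - e / 2) < b by rewrite gt_max t0b/=; lra.
by lra.
Qed.

Lemma trapping c a r C g v t0 t1 : atlas c -> 0 < r -> 0 < C ->
  closed_ball a r `<=` cimg c -> continuous g ->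
  (forall s, cdom c (g s) -> closed_ball a r (c (g s)) ->
     is_derive s 1 (c \o g) (v s) /\ `|v s| <= C) ->
  cdom c (g t0) -> `|c (g t0) - a| < r / 2 ->
  C * `|t1 - t0| <= r / 4 ->
  cdom c (g t1) /\ `|c (g t1) - a| < r.
Proof.
move=> ca r0 C0 aC cg gv ct0 gt0.
have [t01|t10] := leP t0 t1.
  rewrite ger0_norm ?subr_ge0// => t01r.
  exact: (trapping_right ca r0 C0 aC cg gv ct0 gt0 t01 t01r).
rewrite ltr0_norm ?subr_lt0// => t01r.
pose h (t : R) := g (- t); pose vh (t : R) := - v (- t).
have ch : continuous h.
  by move=> t; apply: continuous_comp; [exact: opp_continuous|exact: cg].
have hv s : cdom c (h s) -> closed_ball a r (c (h s)) ->
    is_derive s 1 (c \o h) (vh s) /\ `|vh s| <= C.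
  move=> /gv H /H[dv vC]; split; last by rewrite /vh normrN.
  have := @is_derive_affine _ _ (c \o g) (-1) 0 s (v (- s)).
  rewrite mulN1r addr0 scaleN1r => /(_ dv).
  by congr is_derive; apply/funext => x; rewrite /h /= mulN1r addr0.
have := @trapping_right c a r C h vh (- t0) (- t1) ca r0 C0 aC ch hv.
rewrite /h !opprK; apply=> //; first by rewrite lerN2 ltW.
by move: t01r; rewrite opprB; lra.
Qed.

End Trapping.

Lemma near_dist_le (R : realType) (V W : normedModType R) (f : V -> W) (a : V) (e : R) :
  {for a, continuous f} -> 0 < e -> \forall y \near a, `|f y - f a| <= e.
Proof.
move=> cf e0; apply: (filterS _ ((cvgrPdist_le _ _).1 cf e e0)) => y.
by rewrite distrC.
Qed.

Section Limits.
Context (R : realType) (n : nat) (M : manifold R n) (w : M -> 'M[R]_n.+1)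
  (U : set M) (tau : M -> R) (I : set R).
Hypotheses (hw : symplectic w) (oU : open U).
Hypothesis U_interior : forall x c, U x -> atlas c -> cdom c x ->
  nbhs (c x) (cimg c).
Hypothesis tauC : smooth_from U (tau : _ -> R^o).
Hypothesis tau_regular : forall x, U x -> ham_field w tau x != 0.
Hypothesis slab : forall e, I e -> exists a b (K : set M),
  [/\ a < e < b, compact K, K `<=` U &
      forall x, U x -> a < tau x < b -> K x].
Implicit Types (c : chart R n M) (x : M).

(** All positive periods are recorded, not just the minimal ones. The set E_K of the overview is the
    projection of the pairs whose second component is at most K. *)
Definition periods : set (R * R) :=
  [set p | [/\ I p.1, 0 < p.2 &
     exists2 g, flow_line w U tau p.1 g & forall t, g (t + p.2) = g t]].

Lemma tau_continuous x : U x -> {for x, continuous tau}.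
Proof.
move=> Ux; have [ca cx] := chart_atP x.
have dt := tau_differentiable oU U_interior tauC ca Ux cx.
have cc : {for x, continuous (chart_at x)}.
  by apply: cmap_continuous => //; exact: atlas_chart.
have H : (tau \o cinv (chart_at x)) \o chart_at x @ x --> tau x.
  rewrite -[X in _ --> tau X](atlas_cinvK ca cx).
  apply: (@continuous_comp _ _ _ (chart_at x) (tau \o cinv (chart_at x))) => //.
  exact: differentiable_continuous.
apply: cvg_trans H; apply: near_eq_cvg.
by apply: filterS (cdom_nbhs ca cx) => y cy; rewrite /= atlas_cinvK.
Qed.

Section Limit.
Variables (J : Type) (UF : set_system J) (G : J -> R -> M) (E : J -> R) (gam : R -> M).
Variable e : R.
Hypothesis UFp : UltraFilter UF.
Hypothesis GP : UF [set q | flow_line w U tau (E q) (G q)].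
Hypothesis Glim : forall t, G q t @[q --> UF] --> gam t.
Hypothesis gamU : forall t, U (gam t).
Hypothesis Elim : E q @[q --> UF] --> e.

Let PF : ProperFilter UF. Proof. exact: ultra_proper. Qed.

Let ball_in (a : 'rV[R]_n.+1) (A : set 'rV[R]_n.+1) (r0 : R) : nbhs a A -> 0 < r0 ->
  exists r, [/\ 0 < r, r <= r0 & closed_ball a r `<=` A].
Proof.
move=> /nbhs_closedballP[s sA] r00.
exists (Num.min s%:num r0); split; rewrite ?lt_min ?ge_min ?lexx ?orbT//.
  by rewrite r00 andbT.
move=> y yr; apply: sA; move: yr.
rewrite !closed_ballE ?lt_min ?r00 ?andbT// /closed_ball_/= => /le_trans; apply.
by rewrite ge_min lexx.
Qed.

(** The constant [C] bounds the field near [gam t0], so it is common to all the curves: for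
    ultrafilter-many [q], [G q] stays in the coordinate ball of radius [r] during the time r / (4
    C). This is the equicontinuity estimate. *)
Let local_trap t0 : exists (C r0 : R), [/\ 0 < C, 0 < r0 &
  forall r, 0 < r -> r <= r0 -> let c := chart_at (gam t0) in
    closed_ball (c (gam t0)) r `<=` cimg c /\
    \forall q \near UF, forall t, C * `|t - t0| <= r / 4 ->
       flow_line w U tau (E q) (G q) /\
       cdom c (G q t) /\ closed_ball (c (gam t0)) r (c (G q t))].
Proof.
set x := gam t0; have [ca cx] := chart_atP x; set c := chart_at x in ca cx *.
have Ux : U x by exact: gamU.
have oW := chart_dom_open oU U_interior ca.
have Wx : chart_dom U c (c x) by exists x.
have cX : {for c x, continuous (field_coord w tau c)}.
  exact: (Ck_continuous (field_coord_Ck hw oU U_interior tauC 0 ca)) (mem_set Wx).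
have nX : \forall y \near c x, `|field_coord w tau c y - field_coord w tau c (c x)| <= 1.
  exact: near_dist_le cX ltr01.
have nW : \forall y \near c x, chart_dom U c y by exact: open_nbhs_nbhs.
have [r0 [r00 _ r0W]] := ball_in (filterI nW nX) ltr01.
pose C := `|field_coord w tau c (c x)| + 1.
have C0 : 0 < C by rewrite /C ltr_wpDl.
exists C, r0; split=> // r rgt0 rr0.
have sub : closed_ball (c x) r `<=` closed_ball (c x) r0.
  by move=> y; rewrite !closed_ballE// /closed_ball_/= => /le_trans; exact.
have rW : closed_ball (c x) r `<=` cimg c.
  by move=> y /sub/r0W[[z [cz _] <-] _]; exists z.
split=> //.
have n1 : \forall q \near UF, cdom c (G q t0) by exact: (@Glim t0 _ (cdom_nbhs ca cx)).
have n2 : \forall q \near UF, `|c (G q t0) - c x| < r / 2.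
  have H : c (G q t0) - c x @[q --> UF] --> c x - c x.
    apply: cvgB; last exact: cvg_cst.
    apply: cvg_comp; first exact: (@Glim t0).
    by apply: cmap_continuous => //; exact: atlas_chart.
  by apply: (cvgr_norm_lt _ H); rewrite subrr normr0 divr_gt0.
apply: filterS (filterI GP (filterI n1 n2)) => q [Gq [cq qr]] t tr.
split=> //.
have cg : continuous (G q) by case: Gq.
have dG s : cdom c (G q s) -> closed_ball (c x) r (c (G q s)) ->
    is_derive s 1 (c \o G q) (field_coord w tau c (c (G q s))) /\
    `|field_coord w tau c (c (G q s))| <= C.
  move=> cs /sub/r0W[_ X1]; split.
    exact: (flow_line_chart hw oU U_interior tauC Gq ca cs).
  rewrite /C addrC -[X in `|X|](subrK (field_coord w tau c (c x))).
  by rewrite (le_trans (ler_normD _ _))// lerD2r.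
have [ct tB] := trapping ca rgt0 C0 rW cg dG cq qr tr.
by split=> //; rewrite closed_ballE// /closed_ball_/= distrC ltW.
Qed.

(** Confinement passes to the pointwise limit because coordinate balls are closed in [M]. *)
Let gam_trap t0 : exists (C r0 : R), [/\ 0 < C, 0 < r0 &
  forall r, 0 < r -> r <= r0 -> let c := chart_at (gam t0) in
    closed_ball (c (gam t0)) r `<=` cimg c /\
    forall t, C * `|t - t0| <= r / 4 ->
       cdom c (gam t) /\ closed_ball (c (gam t0)) r (c (gam t))].
Proof.
have [C [r0 [C0 r00 tr]]] := local_trap t0.
exists C, r0; split=> // r rgt0 rr0 c; have [rW nq] := tr r rgt0 rr0; split=> // t tt0.
have [ca cx] := chart_atP (gam t0).
have [_ _ cK _ _] := atlas_chart ca.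
have : (cinv c @` closed_ball (c (gam t0)) r) (gam t).
  apply: (closed_cvg _ _ _ _ (@Glim t)); first exact: chart_ball_closed.
  apply: filterS nq => q /(_ t tt0)[_ [cq qB]].
  by exists (c (G q t)) => //; rewrite atlas_cinvK.
move=> [y yB <-]; have [z cz zy] := rW y yB.
by rewrite -zy cK ?inE// zy.
Qed.

Let small (C r : R) : 0 < C -> 0 < r -> forall t0 : R,
  \forall t \near t0, C * `|t - t0| <= r / 4.
Proof.
move=> C0 r0 t0; apply/nbhs_ballP; exists (r / 4 / C) => /=.
  by rewrite !divr_gt0.
move=> t; rewrite -ball_normE/= distrC => tt0.
by rewrite mulrC -ler_pdivlMr// ltW.
Qed.

(** Pointwise convergence is upgraded to convergence at moving times; the periods, and their
    multiples, vary with [q]. *)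
Lemma limit_along (s : J -> R) t0 : s q @[q --> UF] --> t0 ->
  G q (s q) @[q --> UF] --> gam t0.
Proof.
move=> slim A nA; have [C [r0 [C0 r00 tr]]] := local_trap t0.
have [ca cx] := chart_atP (gam t0).
have nA' := near_cinv U_interior ca (@gamU t0) cx nA.
have [r [rgt0 rr0 rA]] := ball_in nA' r00.
have [_ nq] := tr r rgt0 rr0.
have ns : \forall q \near UF, C * `|s q - t0| <= r / 4 by exact: (slim _ (small C0 rgt0 t0)).
rewrite /= nbhs_simpl/=; apply: filterS (filterI nq ns) => q [H sq].
have [_ [cs sB]] := H _ sq.
by have := rA _ sB; rewrite atlas_cinvK.
Qed.

Lemma limit_continuous : continuous gam.
Proof.
move=> t0 A nA; have [C [r0 [C0 r00 tr]]] := gam_trap t0.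
have [ca cx] := chart_atP (gam t0).
have nA' := near_cinv U_interior ca (@gamU t0) cx nA.
have [r [rgt0 rr0 rA]] := ball_in nA' r00.
have [_ nq] := tr r rgt0 rr0.
rewrite /= nbhs_simpl/=; apply: filterS (small C0 rgt0 t0) => t /nq[ct tB].
by have := rA _ tB; rewrite atlas_cinvK.
Qed.

Lemma limit_derive (t0 : R) :
  is_derive t0 1 (chart_at (gam t0) \o gam) (ham_field w tau (gam t0)).
Proof.
have [ca cx] := chart_atP (gam t0).
have cg : {for t0, continuous gam} by exact: limit_continuous.
have dE := chart_atE hw oU U_interior tauC ca (@gamU t0) cx cg.
apply: dE.1 => {dE}.
have [C [r0 [C0 r00 tr]]] := local_trap t0.
have [C' [r0' [C0' r00' tr']]] := gam_trap t0.
set c := chart_at (gam t0) in ca cx tr tr' *; set x := gam t0 in cx tr tr' *.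
set X := field_coord w tau c.
have cX : {for c x, continuous X}.
  have Wx : chart_dom U c (c x) by exists x => //; split=> //; exact: gamU.
  exact: (Ck_continuous (field_coord_Ck hw oU U_interior tauC 0 ca)) (mem_set Wx).
(* For the curves [G q] this is the mean value inequality, with [eta] and the neighbourhood of [t0]
   independent of [q]; as a closed condition it survives the limit. *)
have key eta : 0 < eta -> \forall t \near t0,
    `|c (gam t) - c x - (t - t0) *: X (c x)| <= eta * `|t - t0|.
  move=> eta0.
  have nX : \forall y \near c x, `|X y - X (c x)| <= eta.
    exact: near_dist_le cX eta0.
  have m0 : 0 < Num.min r0 r0' by rewrite lt_min r00.
  have [r [rgt0 rm rX]] := ball_in nX m0.
  have [rr0 rr0'] : r <= r0 /\ r <= r0' by move: rm; rewrite le_min => /andP[].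
  have [rW nq] := tr r rgt0 rr0; have [_ nt] := tr' r rgt0 rr0'.
  apply: filterS (filterI (small C0 rgt0 t0) (small C0' rgt0 t0)) => t [tt tt'].
  have [ct _] := nt t tt'.
  have cv s : cdom c (gam s) -> c (G q s) @[q --> UF] --> c (gam s).
    move=> cs; apply: cvg_comp; first exact: (@Glim s).
    by apply: cmap_continuous => //; exact: atlas_chart.
  have L : c (G q t) - c (G q t0) - (t - t0) *: X (c x) @[q --> UF] -->
      c (gam t) - c x - (t - t0) *: X (c x).
    by apply: cvgB; [apply: cvgB; exact: cv|exact: cvg_cst].
  have cl : closed [set y : 'rV[R]_n.+1 | `|y| <= eta * `|t - t0|].
    have -> : [set y : 'rV[R]_n.+1 | `|y| <= eta * `|t - t0|] =
        Num.norm @^-1` [set z : R | z <= eta * `|t - t0|] by [].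
    by apply: closed_comp => [y _|]; [exact: norm_continuous|exact: closed_le].
  apply: (closed_cvg _ cl _ _ L).
  apply: filterS nq => q H /=.
  have dq s : C * `|s - t0| <= C * `|t - t0| ->
      is_derive s 1 (c \o G q) (X (c (G q s))) /\ `|X (c (G q s)) - X (c x)| <= eta.
    move=> ss; have [Gq [cs sB]] := H s (le_trans ss tt); split; last exact: rX.
    exact: (flow_line_chart hw oU U_interior tauC Gq ca cs).
  have [t0t|tt0] := leP t0 t.
    rewrite (ger0_norm (_ : 0 <= t - t0)) ?subr_ge0//.
    have sub s : t0 <= s <= t -> C * `|s - t0| <= C * `|t - t0|.
      move=> /andP[? ?]; rewrite ler_wpM2l ?(ltW C0)// !ger0_norm ?subr_ge0//.
      by rewrite lerD2r.
    apply: (@curve_mvt _ _ (c \o G q) (fun s => X (c (G q s))) t0 t eta (X (c x)) t0t (ltW eta0)).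
      by move=> s /sub/dq[].
    by move=> s /sub/dq[].
  have sub s : t <= s <= t0 -> C * `|s - t0| <= C * `|t - t0|.
    move=> /andP[? ?]; rewrite ler_wpM2l ?(ltW C0)// !ler0_norm ?subr_le0 ?(ltW tt0)//.
    by rewrite lerN2 lerD2r.
  have := @curve_mvt _ _ (c \o G q) (fun s => X (c (G q s))) t t0 eta (X (c x))
    (ltW tt0) (ltW eta0).
  move=> /(_ (fun s ss => (dq s (sub s ss)).1) (fun s ss => (dq s (sub s ss)).2)).
  move=> H'; rewrite (distrC t t0) (ger0_norm (_ : 0 <= t0 - t)) ?subr_ge0 ?(ltW tt0)//.
  have -> : c (G q t) - c (G q t0) - (t - t0) *: X (c x) =
      - (c (G q t0) - c (G q t) - (t0 - t) *: X (c x)).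
    by rewrite 2!opprB -[in RHS](opprB t t0) scaleNr [RHS]addrC.
  by rewrite normrN.
have D : (fun h : R => h^-1 *: (((c \o gam) \o shift t0) (h *: (1 : R^o)) - (c \o gam) t0))
    @ 0^' --> X (c x).
  apply/cvgrPdist_le => eta eta0.
  have sh : h + t0 @[h --> (0 : R)] --> t0.
    by rewrite -[X in _ --> X]add0r; apply: cvgD; [exact: cvg_id|exact: cvg_cst].
  have /nbhs_dnbhs := sh _ (key eta eta0); apply: filter_app.
  near=> h => /=; rewrite addrK [h *: (1 : R^o)]mulr1 => H.
  have h0 : h != 0 by near: h; exact: nbhs_dnbhs_neq.
  have -> : X (c x) - h^-1 *: (c (gam (h + t0)) - c (gam t0)) =
      - (h^-1 *: (c (gam (h + t0)) - c x - h *: X (c x))).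
    by rewrite [in RHS]scalerBr scalerA mulVf// scale1r opprB.
  rewrite normrN normrZ normfV mulrC ler_pdivrMr ?normr_gt0//.
split; last exact/cvg_lim.
by apply/cvg_ex; exists (X (c x)).
Unshelve. all: by end_near. Qed.

Lemma limit_flow_line : flow_line w U tau e gam.
Proof.
split; first exact: limit_continuous.
move=> t; split; [exact: gamU| |exact: limit_derive].
apply: (cvg_unique (@norm_hausdorff _ R^o) _ Elim).
have H : tau (G q t) @[q --> UF] --> tau (gam t).
  by apply: cvg_comp; [exact: (@Glim t)|exact: tau_continuous].
apply: cvg_trans H; apply: near_eq_cvg.
by apply: filterS GP => q [_ /(_ t)[_ ->]].
Qed.

End Limit.
Lemma ham_flow_not_constant e g a b : flow_line w U tau e g -> a < b ->
  ~ (forall t, a < t < b -> g t = g a).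
Proof.
move=> Gg ab gc; pose m := (a + b) / 2.
have mab : a < m < b by rewrite /m; lra.
have [cg /(_ m)[Um _ dm]] := Gg.
have := tau_regular Um; rewrite -(@derive_val _ _ _ _ _ _ _ dm).
have -> : 'D_1 (chart_at (g m) \o g) m = 'D_1 (cst (chart_at (g m) (g m)) : R -> _) m.
  apply: near_eq_derive.
  have : \forall t \near m, a < t /\ t < b.
    by apply: filterI; [apply: lt_nbhsr|apply: lt_nbhsl]; case/andP: mab.
  by apply: filterS => t [at_ tb]; rewrite /= (gc m)// (gc t)// at_.
by rewrite derive_cst eqxx.
Qed.

(** An ultrafilter finer than the neighbourhoods of [p] within [periods] makes the chosen orbits
    converge at every time at once, since they eventually lie in a compact slab. *)
Lemma periods_closed p : closure periods p -> I p.1 -> periods p.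
Proof.
move=> clp Ip; have PW : ProperFilter (within periods (nbhs p)).
  exact: within_nbhs_proper.
have [UF [UFu sub]] := ultraFilterLemma PW.
have PF : ProperFilter UF by exact: ultra_proper.
have [q0 [_ _ [g0 _ _]]] : exists q, periods q by have [q []] := clp setT filterT; exists q.
have [G GP] : exists G : R * R -> R -> M, forall q, periods q ->
    flow_line w U tau q.1 (G q) /\ forall t, G q (t + q.2) = G q t.
  (* [g0] is a default value outside [periods], a set of indices that the ultrafilter does not
     see. *)
  exists (fun q => if pselect (periods q) is left h then
     s2val (cid2 (let: And3 _ _ H := h in H)) else g0) => q Pq.
  by case: pselect => // -[I1 I2 H]; case: cid2.
have UFP : UF periods by apply: sub; exact: withinT.
have Up A : nbhs p A -> UF A.
  by move=> nA; apply: sub; apply: filterS nA => q Aq _.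
have lim1 : q.1 @[q --> UF] --> p.1.
  move=> A nA; apply: Up; case: (p) nA => p1 p2 /= nA.
  exact: (@cvg_fst _ _ (nbhs p1) (nbhs p2) _ _ nA).
have lim2 : q.2 @[q --> UF] --> p.2.
  move=> A nA; apply: Up; case: (p) nA => p1 p2 /= nA.
  exact: (@cvg_snd _ _ (nbhs p1) (nbhs p2) _ _ nA).
have [a [b [K [/andP[ae eb] cK KU slabK]]]] := slab Ip.
have GK t : UF [set q | K (G q t)].
  have n1 : \forall q \near UF, a < q.1 by exact: (lim1 _ (lt_nbhsr ae)).
  have n2 : \forall q \near UF, q.1 < b by exact: (lim1 _ (lt_nbhsl eb)).
  apply: filterS (filterI UFP (filterI n1 n2)) => q [/GP[[_ /(_ t)[Ut tq _]] _] [aq qb]].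
  by apply: slabK => //; rewrite tq aq.
have [gam gamP] : exists gam : R -> M, forall t,
    K (gam t) /\ G q t @[q --> UF] --> gam t.
  have H t : exists x, K x /\ G q t @[q --> UF] --> x.
    have UG := ultra_fmap (fun q => G q t) UFu.
    by move: cK; rewrite compact_ultra => /(_ _ UG (GK t))[x [Kx Gx]]; exists x.
  by exists (fun t => sval (cid (H t))) => t; case: cid.
have gamU t : U (gam t) by apply: KU; case: (gamP t).
have Glim t : G q t @[q --> UF] --> gam t by case: (gamP t).
have GF : UF [set q | flow_line w U tau q.1 (G q)].
  by apply: filterS UFP => q /GP[].
have along := limit_along UFu GF Glim gamU.
have gF : flow_line w U tau p.1 gam := limit_flow_line UFu GF Glim gamU lim1.
have hM : hausdorff_space M := @manifold_hausdorff _ _ M.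
have per t : gam (t + p.2) = gam t.
  apply: (cvg_unique hM _ (Glim t)).
  have H : G q (t + q.2) @[q --> UF] --> gam (t + p.2).
    by apply: along; apply: cvgD => //; exact: cvg_cst.
  apply: cvg_trans H; apply: near_eq_cvg.
  by apply: filterS UFP => q /GP[_ ->].
split=> //; last by exists gam.
have pos : 0 <= p.2.
  apply: (closed_cvg _ (@closed_ge _ 0) _ _ lim2).
  by apply: filterS UFP => q [_ /ltW].
rewrite lt_neqAle pos andbT; apply/negP => /eqP p0.
apply: (@ham_flow_not_constant p.1 gam 0 1 gF ltr01) => t /andP[t0 _].
apply: (cvg_unique hM _ (Glim 0)).
(* If the periods tend to 0, their multiples approximate every t, and the limit is
   constant. *)
pose k (q : R * R) := Num.trunc (t / q.2).
have klim : (k q)%:R * q.2 @[q --> UF] --> t.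
  apply/cvgrPdist_le => e e0.
  have n2 : \forall q \near UF, q.2 < e.
    by apply: (lim2 _ (lt_nbhsl _)); rewrite -p0.
  apply: filterS (filterI UFP n2) => q [[_ q0' _] qe].
  have /andP[k1 k2] := truncn_itv (divr_ge0 (ltW t0) (ltW q0')).
  move: k1 k2; rewrite ler_pdivlMr// ltr_pdivrMr// -/(k q) -natr1 mulrDl mul1r => k1 k2.
  by rewrite ger0_norm ?subr_ge0//; lra.
apply: cvg_trans (along _ _ klim); apply: near_eq_cvg.
apply: filterS UFP => q /GP[_ Gp].
suff H (j : nat) : G q (j%:R * q.2) = G q 0 by rewrite H.
elim: j => [|j IH]; first by rewrite mul0r.
by rewrite -natr1 mulrDl mul1r Gp.
Qed.

End Limits.

(** * Closed characteristics *)

(** Near [t] each difference quotient of [f] is one of [fa] or [fb], and both tend to [l]. It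
    handles the joints of a closed-up curve. *)
Lemma is_derive_select (R : realType) (V : normedModType R) (f fa fb : R -> V)
    (t : R) (l : V) :
  is_derive t 1 fa l -> is_derive t 1 fb l -> fa t = f t -> fb t = f t ->
  (\forall s \near t, f s = fa s \/ f s = fb s) -> is_derive t 1 f l.
Proof.
move=> [da la] [db lb] at_ bt nf.
pose Q (h : R -> V) := fun u : R => u^-1 *: ((h \o shift t) (u *: (1 : R^o)) - h t).
have La : Q fa @ 0^' --> l by rewrite -la; exact: da.
have Lb : Q fb @ 0^' --> l by rewrite -lb; exact: db.
have nf0 : \forall u \near 0^', f (u + t) = fa (u + t) \/ f (u + t) = fb (u + t).
  apply: nbhs_dnbhs; have sh : u + t @[u --> (0 : R)] --> t.
    by rewrite -[X in _ --> X]add0r; apply: cvgD; [exact: cvg_id|exact: cvg_cst].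
  exact: (sh _ nf).
have L : Q f @ 0^' --> l.
  apply/cvgrPdist_le => e e0.
  have Ea := (cvgrPdist_le _ _).1 La e e0.
  have Eb := (cvgrPdist_le _ _).1 Lb e e0.
  near=> u.
  have ea : `|l - Q fa u| <= e by near: u; exact: Ea.
  have eb : `|l - Q fb u| <= e by near: u; exact: Eb.
  have : f (u + t) = fa (u + t) \/ f (u + t) = fb (u + t) by near: u.
  move: ea eb; rewrite /Q /= ![u *: (1 : R^o)]mulr1 at_ bt => ea eb [->|->] //.
by split; [apply/cvg_ex; exists l|exact/cvg_lim].
Unshelve. all: by end_near. Qed.

Section Loops.
Context (R : realType) (n : nat) (M : manifold R n) (w : M -> 'M[R]_n.+1)
  (U : set M) (tau : M -> R) (I : set R).
Hypotheses (hw : symplectic w) (oU : open U).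
Hypothesis U_interior : forall x c, U x -> atlas c -> cdom c x ->
  nbhs (c x) (cimg c).
Hypothesis tauC : smooth_from U (tau : _ -> R^o).
Hypothesis tau_regular : forall x, U x -> ham_field w tau x != 0.
Hypothesis slab : forall e, I e -> exists a b (K : set M),
  [/\ a < e < b, compact K, K `<=` U &
      forall x, U x -> a < tau x < b -> K x].
Implicit Types (c : chart R n M) (x : M).

Lemma flow_line_shift e g s : flow_line w U tau e g ->
  flow_line w U tau e (fun t => g (t + s)).
Proof.
move=> [cg fg]; split.
  move=> t; apply: (@continuous_comp _ _ _ (fun t => t + s) g); last exact: cg.
  by apply: cvgD; [exact: cvg_id|exact: cvg_cst].
move=> t; have [Ut te dt] := fg (t + s); split=> //.
have := @is_derive_affine _ _ (chart_at (g (t + s)) \o g) 1 s t (ham_field w tau (g (t + s))).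
rewrite mul1r scale1r => /(_ dt).
by congr is_derive; apply/funext => r; rewrite /= mul1r.
Qed.

(* A flow line that comes back to a point can be closed up there, because the two
   velocities agree; uniqueness of the solutions of the equation is not needed. *)
Lemma flow_line_loop e g a b : flow_line w U tau e g -> a < b -> g a = g b ->
  exists2 h, flow_line w U tau e h & forall t, h (t + (b - a)) = h t.
Proof.
move=> Gg ab gab; set p := b - a; have p0 : 0 < p by rewrite subr_gt0.
pose fl (r : R) : int := Num.floor (r / p).
have flE r (m : int) : m%:~R * p <= r < (m + 1)%:~R * p -> fl r = m.
  by move=> mr; apply: floor_def; rewrite ler_pdivlMr// ltr_pdivrMr.
have fl_itv r : (fl r)%:~R * p <= r < (fl r + 1)%:~R * p.
  by have := floor_itv (r / p); rewrite ler_pdivlMr// ltr_pdivrMr.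
(* The argument is [a] plus the remainder of [r] modulo [p]: the arc from [a] to [b] is run again
   and again. *)
pose h r := g (r + (a - (fl r)%:~R * p)).
have hp t : h (t + p) = h t.
  have : fl (t + p) = fl t + 1.
    by apply: flE; have := fl_itv t; rewrite !intrD; lra.
  by rewrite /h => ->; congr g; rewrite intrD; ring.
(* At a multiple of [p], [h] follows [al] to the right and [be], the previous run, to the left; they
   meet because [g a = g b]. Elsewhere one shift of [g] suffices. *)
have sel t : exists al be, [/\ flow_line w U tau e al, flow_line w U tau e be,
    al t = h t, be t = h t & \forall s \near t, h s = al s \/ h s = be s].
  pose al r := g (r + (a - (fl t)%:~R * p)).
  have Ga : flow_line w U tau e al by exact: flow_line_shift.
  have /andP[f1 f2] := fl_itv t.
  have n2 : \forall s \near t, s < (fl t + 1)%:~R * p by exact: lt_nbhsl.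
  move: f1; rewrite le_eqVlt => /orP[/eqP ft|ft]; last first.
    have n1 : \forall s \near t, (fl t)%:~R * p < s by exact: lt_nbhsr.
    exists al, al; split=> //; apply: filterS (filterI n1 n2) => s [s1 s2]; left.
    by rewrite /h (@flE s (fl t))// (ltW s1).
  pose be r := g (r + (b - (fl t)%:~R * p)).
  exists al, be; split=> //.
  - exact: flow_line_shift.
  - by rewrite /be /h ft !(addrCA t) subrr !addr0 gab.
  - have n1 : \forall s \near t, (fl t - 1)%:~R * p < s.
      by apply: lt_nbhsr; move: ft; rewrite intrB; lra.
    apply: filterS (filterI n1 n2) => s [s1 s2].
    have [sl|sl] := leP ((fl t)%:~R * p) s.
      by left; rewrite /h (@flE s (fl t))// sl.
    right; rewrite /h (@flE s (fl t - 1)) ?(ltW s1) ?subrK// /be.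
    by congr g; rewrite intrB /p; ring.
exists h => //; split.
  move=> t; have [al [be [[ca _] [cb _] alt bet ns]]] := sel t.
  move=> A nA; have na : \forall s \near t, A (al s) by apply: ca; rewrite alt.
  have nb : \forall s \near t, A (be s) by apply: cb; rewrite bet.
  rewrite /= nbhs_simpl/=; apply: filterS (filterI ns (filterI na nb)) => s.
  by move=> [hs [Aa Ab]] /=; case: hs => ->.
move=> t; have [al [be [[_ fa] [_ fb] alt bet ns]]] := sel t.
have [Ut te da] := fa t; have [_ _ db] := fb t.
rewrite alt in Ut te da; rewrite bet in db; split=> //.
apply: (is_derive_select da db); rewrite /= ?alt ?bet//.
by apply: filterS ns => s [->|->]; [left|right].
Qed.

(** [periods_closed] makes the infimum of the periods a period, and in particular positive. *)
Lemma minimal_period e T : periods w U tau I (e, T) ->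
  exists2 T0, periods w U tau I (e, T0) &
    forall T', periods w U tau I (e, T') -> T0 <= T'.
Proof.
move=> PT; pose B := [set T' | periods w U tau I (e, T')].
have lB : has_lbound B by exists 0 => T' [_ /ltW].
have hB : has_inf B by split=> //; exists T.
have Ie : I e by case: PT.
exists (inf B); last by move=> T' PT'; exact: ge_inf.
apply: periods_closed => // A /nbhs_ballP[r /= r0 rA].
have [T' PT' T'r] := inf_adherent r0 hB.
exists (e, T'); split=> //; apply: rA; split; rewrite /=; first exact: ballxx.
have T'i : inf B <= T' by exact: ge_inf.
by rewrite -ball_normE/= distrC ger0_norm ?subr_ge0//; lra.
Qed.

(** A loop of period T becomes a map on the circle R/Z when run at speed T. The equation is required
    in every chart of the atlas, to match [smooth_into]. *)
Definition scaled_flow (k : R) (g : R -> M) := continuous g /\ forall t, U (g t) /\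
  forall c, atlas c -> cdom c (g t) ->
    is_derive t 1 (c \o g) (k *: field_coord w tau c (c (g t))).

Lemma flow_line_scaled e g k s : flow_line w U tau e g ->
  scaled_flow k (fun t => g (k * t + s)).
Proof.
move=> Gg; have [cg fg] := Gg; split.
  move=> t; apply: (@continuous_comp _ _ _ (fun t => k * t + s) g); last exact: cg.
  by apply: cvgD; [apply: cvgMl_tmp; exact: cvg_id|exact: cvg_cst].
move=> t; have [Ut _ _] := fg (k * t + s); split=> // c ca ct.
apply: (@is_derive_affine _ _ (c \o g)).
exact: (flow_line_chart hw oU U_interior tauC Gg ca ct).
Qed.

(** Bootstrapping: the derivative of the curve is a smooth function of the curve, so each order of
    regularity yields the next. *)
Lemma scaled_flow_smooth k g : scaled_flow k g -> smooth_into (setT : set R^o) g.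
Proof.
move=> [cg fg]; split; first exact: continuous_subspaceT.
move=> c ca; rewrite setTI; set V := g @^-1` cdom c.
have oV : open V.
  by apply: open_comp => [t _|]; [exact: cg|case: (atlas_chart ca)].
apply: Ck_smooth_on => // j.
have oW := chart_dom_open oU U_interior ca.
pose X := field_coord w tau c.
have dV (t : R) : V t -> is_derive t 1 (c \o g) (k *: X (c (g t))).
  by move=> Vt; have [_ /(_ c ca Vt)] := fg t.
have diffV (t : R^o) : V t -> differentiable (c \o g : R^o -> _) t.
  by move=> /dV[d _]; exact/derivable1_diffP.
have VW t : V t -> chart_dom U c ((c \o g) t).
  by move=> Vt; exists (g t) => //; split=> //; case: (fg t).
elim: j => [|j IH]; first by split=> // t /set_mem/diffV/differentiable_continuous.
split=> [t /set_mem/diffV/differentiable_continuous//|v].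
split=> [t /diffV/diff_derivable|]; first exact.
have XC i : Ck i (chart_dom U c) X by exact: field_coord_Ck.
apply: (@Ck_eq _ _ _ _ _ (fun t => (v * k) *: X (c (g t)))) => //.
  move=> t /set_mem Vt; rewrite deriveE; last exact: diffV.
  rewrite -[X in 'd _ _ X]mulr1 -[v * 1]/(v *: (1 : R^o)) linearZ/=.
  rewrite -deriveE; last exact: diffV.
  by have [_ ->] := dV t Vt; rewrite scalerA.
apply/(Ck_mxP _ _ oV) => a b.
apply: (@Ck_eq _ _ _ _ _ (cst (v * k) \* (fun t => X (c (g t)) a b) : R^o -> R^o)) => //.
  by move=> t _; rewrite mxE.
apply: Ck_mul => //; first exact: Ck_cst.
move: a b; apply: (Ck_mxP _ _ oV).1.
exact: (Ck_comp_mx oV oW VW diffV IH (XC j)).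
Qed.

Lemma scaled_flow_velocity k g t : scaled_flow k g ->
  velocity g t = k *: ham_field w tau (g t).
Proof.
move=> [_ /(_ t)[Ut fg]]; have [ca ct] := chart_atP (g t).
rewrite /velocity derive1E; have [_ ->] := fg _ ca ct.
rewrite -(field_coordE hw oU U_interior tauC ca Ut ct).
congr (_ *: _); rewrite /jac.
have -> : 'J (chart_at (g t) \o cinv (chart_at (g t))) (chart_at (g t) (g t)) = 1%:M.
  apply/row_matrixP => i; rewrite !rowE mulmx1.
  rewrite -[_ *m _]/(_ *m jac (chart_at (g t)) (chart_at (g t)) (g t)).
  rewrite -(derive_trans U_interior)// -[RHS](derive_id (chart_at (g t) (g t))).
  apply: near_eq_derive.
  by apply: filterS (near_cinvK U_interior ca Ut ct) => y [].
by rewrite mulmx1.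
Qed.

Lemma differentialE (f : M -> R) x v : U x ->
  differential U f x v = 'D_v (f \o cinv (chart_at x) : _ -> R^o) (chart_at x x).
Proof.
move=> Ux; have [ca cx] := chart_atP x.
rewrite /differential derive_in_nbhs//.
by apply: open_nbhs_nbhs; split; [exact: chart_dom_open|exists x].
Qed.

Variables (Sl : R -> set M).
Hypothesis SlP : forall e x, I e -> Sl e x <-> U x /\ tau x = e.

(** The pairing is - d tau (u), and [tau] is constant along a curve contained in the level. *)
Lemma tangent_pairing e x u : I e -> tangent_space (Sl e) x u ->
  pairing w x (ham_field w tau x) u = 0.
Proof.
move=> Ie [J [h [[oJ J0] [hc hs] hS hx hu]]].
have lev t : J t -> U (h t) /\ tau (h t) = e.
  by move=> Jt; apply/SlP => //; apply: hS; exists t.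
have [Ux _] := lev 0 J0; rewrite hx in Ux.
have [ca cx] := chart_atP x.
have hc0 : {for 0, continuous h}.
  by move: hc; rewrite continuous_open_subspace//; apply; rewrite inE.
have nJ : \forall t \near (0 : R), J t by exact: open_nbhs_nbhs.
have nc : \forall t \near (0 : R), cdom (chart_at x) (h t).
  by apply: hc0; rewrite hx; exact: cdom_nbhs.
have [|W [g [oW W0 gk gE]]] := smooth_on_derive_extension (hs _ ca) (x := 0).
  by split => //; rewrite /= hx.
have nW : \forall t \near (0 : R), W t by exact: open_nbhs_nbhs.
have dh : is_derive (0 : R) 1 (chart_at x \o h) u.
  have dd : derivable (chart_at x \o h : R^o -> _) (0 : R^o) 1.
    apply: (near_eq_derivable (f := g)); last exact: (Ck_derivable (gk 1%N)).
    by apply: filterS (filterI nW (filterI nJ nc)) => t [Wt [Jt ct]]; rewrite gE.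
  by split=> //; rewrite -hu /velocity hx derive1E.
rewrite (pairing_ham_field hw oU U_interior tauC)// differentialE//.
have dt := tau_differentiable oU U_interior tauC ca Ux cx.
have e0 : (chart_at x \o h) 0 = chart_at x x by rewrite /= hx.
have dt' : differentiable (tau \o cinv (chart_at x) : _ -> R^o) ((chart_at x \o h) 0).
  by rewrite e0.
have [_ D] := is_derive_comp_curve dh dt'.
suff H : 'D_u (tau \o cinv (chart_at x) : _ -> R^o) (chart_at x x) = 0.
  by rewrite H; exact: (@oppr0 R).
rewrite (deriveE u dt) -e0 -D.
apply: etrans (derive_cst (e : R^o) (0 : R) (1 : R)).
apply: (near_eq_derive (W := R^o)).
by apply: filterS (filterI nJ nc) => t [/lev[_ te] ct]; rewrite /= atlas_cinvK.
Qed.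

(* A self-intersection of an orbit of minimal period would give a shorter loop. *)
Lemma closed_characteristic_exists e T : periods w U tau I (e, T) ->
  closed_characteristics w (Sl e) !=set0.
Proof.
move=> /minimal_period[T0 [/= Ie T00 [gam Gg gp]] T0min].
pose g t := gam (T0 * t).
have scaled s : scaled_flow T0 (fun t => gam (T0 * t + s)) by exact: (flow_line_scaled T0 s Gg).
have Gs : scaled_flow T0 g.
  by have := scaled 0; congr scaled_flow; apply/funext => t; rewrite addr0.
have gSl t : Sl e (gam t) by apply/SlP => //; case: Gg => _ /(_ t)[].
have vel t : velocity g t = T0 *: ham_field w tau (g t) by exact: scaled_flow_velocity.
have inj s t : s \in `[0, 1[%R -> t \in `[0, 1[%R -> s < t -> g s = g t -> False.
  rewrite !in_itv/= => s01 t01 st gst.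
  have sT : T0 * s < T0 * t by rewrite ltr_pM2l.
  have [h Gh hp] := flow_line_loop Gg sT gst.
  have : T0 <= T0 * t - T0 * s.
    by apply: T0min; split=> //=; [rewrite subr_gt0|exists h].
  rewrite -mulrBr ler_pMr//; lra.
exists (range g), g; split=> //.
- split.
  + exact: scaled_flow_smooth Gs.
  + by move=> t; rewrite /g mulrDr mulr1 gp.
  + move=> s t sI tI gst; case: (ltgtP s t) => // st; exfalso.
      exact: (inj s t).
    exact: (inj t s).
  + move=> t; rewrite vel scaler_eq0 negb_or gt_eqF//=.
    by apply: tau_regular; case: Gg => _ /(_ (T0 * t))[].
- by move=> _ [t _ <-]; exact: gSl.
- move=> t; split.
    exists setT, (fun s => g (s + t)); split.
    + by split=> //; exact: openT.
    + have := scaled_flow_smooth (scaled (T0 * t)).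
      by congr smooth_into; apply/funext => s; rewrite /g mulrDr.
    + by move=> _ [s _ <-]; exact: gSl.
    + by rewrite add0r.
    + rewrite (_ : (fun s => g (s + t)) = (fun s => gam (T0 * s + T0 * t))).
        by rewrite (scaled_flow_velocity _ (scaled (T0 * t))) vel mulr0 add0r.
      by apply/funext => s; rewrite /g mulrDr.
  move=> u tu; rewrite vel /pairing -!scalemxAl mxE.
  by have := tangent_pairing Ie tu; rewrite /pairing => ->; rewrite mulr0.
Qed.

End Loops.

(** * Admissible functions of the level parameter *)

Lemma locally_constant (R : realType) (T : topologicalType) (g : R -> T) (s t : R) :
  hausdorff_space T -> continuous g ->
  (forall r, \forall u \near r, g u = g r) -> g s = g t.
Proof.
move=> hT cg lg.
have cT : connected [set: R].
  by apply/connected_intervalP => x y _ _ z _.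
have op : open [set u | g u = g t].
  rewrite openE => r /= gr; rewrite /interior -gr; exact: lg.
have cl : closed [set u | g u = g t].
  have -> : [set u | g u = g t] = g @^-1` [set g t] by [].
  apply: closed_comp => [u _|]; first exact: cg.
  exact/accessible_closed_set1/hausdorff_accessible.
have E : [set u | g u = g t] = setT.
  apply: cT; first by exists t.
  - by exists [set u | g u = g t]; rewrite ?setTI.
  - by exists [set u | g u = g t]; rewrite ?setTI.
by rewrite -[_ = _]/([set u | g u = g t] s) E.
Qed.

Section Admissible.
Context (R : realType) (n : nat) (M : manifold R n) (w : M -> 'M[R]_n.+1)
  (U : set M) (tau : M -> R) (I : set R).
Hypotheses (hw : symplectic w) (oU : open U).
Hypothesis U_interior : forall x c, U x -> atlas c -> cdom c x ->
  nbhs (c x) (cimg c).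
Hypothesis tauC : smooth_from U (tau : _ -> R^o).
Implicit Types (c : chart R n M) (x : M).

Lemma pairingZr x (u v : 'rV[R]_n.+1) (a : R) :
  pairing w x u (a *: v) = a * pairing w x u v.
Proof. by rewrite /pairing linearZ/= -scalemxAr mxE. Qed.

Lemma differential_comp (f : R^o -> R^o) x v : (forall k, Ck k setT f) -> U x ->
  differential U (f \o tau) x v = 'D_1 f (tau x) * differential U tau x v.
Proof.
move=> fk Ux; have [ca cx] := chart_atP x.
rewrite !(differentialE oU U_interior)//.
have dt := tau_differentiable oU U_interior tauC ca Ux cx.
have e : (tau \o cinv (chart_at x)) (chart_at x x) = tau x by rewrite /= atlas_cinvK.
have df : differentiable f ((tau \o cinv (chart_at x)) (chart_at x x)).
  by rewrite e; exact: (Ck_R_differentiable _ (fk 1%N)).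
have H := derive_comp v dt df.
rewrite -[LHS]/('D_v (f \o (tau \o cinv (chart_at x)) : _ -> R^o) (chart_at x x)) H.
rewrite (deriveE _ df) -[X in 'd _ _ X]mulr1.
rewrite -[_ * 1]/(_ *: (1 : R^o)) linearZ -(deriveE _ df) e.
exact: mulrC.
Qed.

Lemma hamiltonian_vector_comp (f : R^o -> R^o) x v : (forall k, Ck k setT f) -> U x ->
  hamiltonian_vector w U (f \o tau) x v -> v = 'D_1 f (tau x) *: ham_field w tau x.
Proof.
move=> fk Ux hv; apply/eqP; rewrite -subr_eq0; apply/eqP.
case: hw => _ _ _ nd; apply: (nd x) => u.
have := hv u; rewrite differential_comp//.
have := pairing_ham_field hw oU U_interior tauC u Ux.
rewrite /pairing => E1 E2.
have -> : ((v - 'D_1 f (tau x) *: ham_field w tau x) *m w x *m u^T) 0 0 =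
    (v *m w x *m u^T) 0 0 -
    ('D_1 f (tau x) : R) * (ham_field w tau x *m w x *m u^T) 0 0.
  by rewrite !mulmxBl -!scalemxAl [LHS]mxE [X in _ + X]mxE [X in _ - X]mxE.
by rewrite E1 E2 mulrN opprK addNr.
Qed.

(** Conservation: the velocity is a multiple of the field X of [tau], and d tau (X) = - omega(X, X)
    = 0. *)
Lemma hamiltonian_orbit_tau (f : R^o -> R^o) g : (forall k, Ck k setT f) ->
  hamiltonian_orbit w U (f \o tau) g -> forall s t, tau (g s) = tau (g t).
Proof.
move=> fk [cg og] s t; apply: (@is_derive_0_is_cst R (tau \o g)) => r.
have [Ur dr hr] := og r; have [ca cr] := chart_atP (g r).
set c := chart_at (g r) in ca cr dr *.
have dt := tau_differentiable oU U_interior tauC ca Ur cr.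
have dg : is_derive r 1 (c \o g) (velocity g r) by split=> //; rewrite /velocity derive1E.
have H := is_derive_comp_curve (f := tau \o cinv c : _ -> R^o) dg dt.
apply: (@near_eq_is_derive _ _ _ ((tau \o cinv c) \o (c \o g))).
  have : \forall u \near r, cdom c (g u) by exact: (cg r _ (cdom_nbhs ca cr)).
  by apply: filterS => u cu; rewrite /= atlas_cinvK.
have E : 'd (tau \o cinv c : _ -> R^o) ((c \o g) r) (velocity g r) = 0.
  rewrite -(deriveE _ dt) -(differentialE oU U_interior tau _ Ur).
  rewrite (hamiltonian_vector_comp fk Ur hr).
  set k := 'D_1 f _.
  have := pairing_ham_field hw oU U_interior tauC (k *: ham_field w tau (g r)) Ur.
  move=> /(congr1 -%R); rewrite opprK => <-.
  have [_ _ anti _] := hw.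
  have : pairing w (g r) (ham_field w tau (g r)) (ham_field w tau (g r)) = 0.
    have := anti (g r) (ham_field w tau (g r)) (ham_field w tau (g r)); lra.
  by rewrite pairingZr => ->; rewrite mulr0 oppr0.
by rewrite -E.
Qed.

Lemma admissible_of_profile (f : R^o -> R^o) (K : R) (V : set R) :
  (forall k, Ck k setT f) -> V `<=` I ->
  (forall e T, V e -> T <= K -> ~ periods w U tau I (e, T)) ->
  (forall x : R, `|'D_1 f x : R| <= K /\ ('D_1 f x != 0 -> V x)) ->
  hz_admissible w U (f \o tau).
Proof.
move=> fk VI nP fV g T /andP[T0 T1] og gT.
have tg s t : tau (g s) = tau (g t) by exact: hamiltonian_orbit_tau og s t.
set e := tau (g 0); pose k : R := 'D_1 f e.
have [cg ogt] := og.
have dg (t : R) : U (g t) /\ is_derive t 1 (chart_at (g t) \o g) (k *: ham_field w tau (g t)).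
  have [Ut dt ht] := ogt t; split=> //; split=> //.
  rewrite -derive1E -[LHS]/(velocity g t) (hamiltonian_vector_comp fk Ut ht).
  by rewrite (tg t 0).
(* At speed 0 the velocity vanishes in the chart chosen at each moment. It is transported to one
   fixed chart, where the curve is locally constant; connectedness of the line then gives
   constancy. *)
have [k0|k0] := eqVneq k 0.
  move=> s t; apply: locally_constant => [|//|r].
    exact: (@manifold_hausdorff _ _ M).
  have [Ur _] := dg r; have [ca cr] := chart_atP (g r).
  set c := chart_at (g r) in ca cr *.
  have nc : \forall u \near r, cdom c (g u) by exact: (cg r _ (cdom_nbhs ca cr)).
  have [d /= d0 Bd] := (nbhs_ballP _ _).1 nc.
  have dz (u : R) : ball r d u -> is_derive u 1 (c \o g) 0.
    move=> /Bd cu; have [Uu du] := dg u; have [cb cbu] := chart_atP (g u).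
    have := change_chart U_interior cb ca Uu cbu cu (cg u) du.
    by rewrite k0 scale0r mul0mx.
  apply/nbhs_ballP; exists d => //= u ru.
  have inB (a b x : R) : ball r d a -> ball r d b -> a <= x <= b -> ball r d x.
    rewrite -ball_normE/= !ltr_norml; lra.
  have key (a b : R) : ball r d a -> ball r d b -> a <= b -> c (g b) = c (g a).
    move=> ra rb ab.
    have := @curve_mvt _ _ (c \o g) (fun=> 0) a b 0 0 ab (lexx 0).
    move=> /(_ (fun y yI => dz y (inB a b y ra rb yI))).
    have z0 (x : R) : a <= x <= b -> `|0 - 0 : 'rV[R]_n.+1| <= 0 by rewrite subr0 normr0.
    move=> /(_ z0); rewrite mul0r scaler0 subr0 normr_le0 subr_eq0 => /eqP.
    by [].
  have rr : ball r d r by exact: ballxx.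
  have cE : c (g u) = c (g r).
    by have [ur|/ltW ur] := leP u r; [apply/esym|]; exact: key.
  by rewrite -(atlas_cinvK ca (Bd u ru)) cE atlas_cinvK.
exfalso; have [kK /(_ k0) Ve] := fV e.
have kp : 0 < `|k| by rewrite normr_gt0.
apply: (nP e (`|k| * T) Ve).
  by rewrite (le_trans _ kK)// ler_piMr.
split => /=; [exact: VI|exact: mulr_gt0|].
exists (fun t => g (k^-1 * t)).
  split.
    move=> t; apply: (@continuous_comp _ _ _ (fun t => k^-1 * t) g); last exact: cg.
    by apply: cvgMl_tmp; exact: cvg_id.
  move=> t; have [Ut dt] := dg (k^-1 * t); split=> //; first exact: tg.
  have := @is_derive_affine _ _ (chart_at (g (k^-1 * t)) \o g) k^-1 0 t
    (k *: ham_field w tau (g (k^-1 * t))).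
  rewrite addr0 scalerA mulVf// scale1r => /(_ dt).
  by congr is_derive; apply/funext => r; rewrite /= addr0.
move=> t; rewrite mulrDr mulrA.
have [k1|k1] := leP 0 k.
  by rewrite ger0_norm// mulVf// mul1r gT.
(* For negative [k] the orbit is run backwards, and the shift by [|k| * T] becomes a shift by
   [- T]. *)
rewrite ltr0_norm// mulrN mulVf// mulN1r.
by rewrite -[in RHS](subrK T (k^-1 * t)) gT.
Qed.

End Admissible.

Section Profiles.
Context (R : realType) (n : nat) (M : manifold R n) (S : set M) (I : set R)
  (U : set M) (psi : M -> R -> M) (tau : M -> R).
Hypotheses (hS : hypersurface S) (hpsi : thickening S I U psi).
Hypothesis U_interior : forall x c, U x -> atlas c -> cdom c x ->
  nbhs (c x) (cimg c).
Hypothesis tauC : smooth_from U (tau : _ -> R^o).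
Hypothesis tau_psi : forall x t, S x -> I t -> tau (psi x t) = t.

Lemma hamiltonian_of_profile (f : R^o -> R^o) (m a b : R) :
  (forall k, Ck k setT f) -> (forall x : R, 0 <= f x <= m) ->
  a <= b -> (forall t, a <= t <= b -> I t) ->
  (forall x : R, x <= a \/ b <= x -> f x = m) ->
  (exists c r : R, [/\ a <= c <= b, 0 < r & forall y, `|y - c| < r -> f y = 0]) ->
  hamiltonian U (f \o tau) m.
Proof.
move=> fk f0m ab abI fm [c0 [r [c0ab r0 fc]]].
have [_ [oU UE] _ _ _] := hpsi.
have [y Sy] : S !=set0 by case: hS => _ _ _ [].
have Upsi x t : S x -> I t -> U (psi x t).
  by move=> Sx It; rewrite -UE; exists x => //; exists t.
split.
- move=> c ca; have oW := chart_dom_open oU U_interior ca.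
  apply: Ck_smooth_on => // k.
  apply: (@Ck_comp_R _ _ k _ setT (tau \o cinv c)) => //.
  + exact: openT.
  + by move=> _ [x [cx Ux] <-]; exact: (tau_differentiable oU U_interior tauC).
  + exact: (tau_Ck oU U_interior tauC).
- split; first by move=> x _; exact: f0m.
  have Ia : I a by apply: abI; rewrite lexx ab.
  exists (psi y a); first exact: Upsi.
  by rewrite /= tau_psi// fm//; left.
- exists (U `&` tau @^-1` ball c0 r); split.
  + have ct x : x \in U -> {for x, continuous tau}.
      by move=> /set_mem; exact: (tau_continuous oU U_interior tauC).
    exact: (continuous_inP _ oU).1 ct _ (ball_open _ _).
  + exists (psi y c0); split; first exact/Upsi/abI.
    by rewrite /= tau_psi//; [exact: ballxx|exact: abI].
  + by move=> x [].
  + by move=> x [_]; rewrite /= -ball_normE/= distrC => /fc.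
- exists [set psi x t | x in S & t in `[a, b]]; split.
  + exact: (compact_slab hS hpsi).
  + by move=> _ [x Sx [t tab <-]]; move: tab; rewrite /= in_itv/= => /abI; exact: Upsi.
  + move=> x [Ux nK] /=; have [at_|ta] := leP (tau x) a; first by apply: fm; left.
    have [bt|tb] := leP b (tau x); first by apply: fm; right.
    exfalso; apply: nK.
    have [z Sz [t It ztx]] : [set psi x t | x in S & t in I] x by rewrite UE.
    exists z => //; exists t => //=.
    by rewrite in_itv/= -(tau_psi Sz It) ztx !ltW.
Qed.

End Profiles.

(** * The measure of the gaps *)

Section NullSets.
Context {R : realType}.
Local Notation mu := (@completed_lebesgue_measure R).

(** A compact [L] inside [V] of almost full measure keeps a distance [d] from the complement. In a
    grid of mesh at most [d] each cell that meets [L] lies in [V], so the good cells cover [L]. *)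
Lemma grid_bound (V : set R) (a b B : R) : a < b -> open V -> V `<=` `]a, b[ ->
  (forall (N : nat) (good : pred 'I_N.+1), let h := (b - a) / N.+1%:R in
     (forall (i : 'I_N.+1) x, good i -> a + i%:R * h <= x <= a + i.+1%:R * h -> V x) ->
     h * #|good|%:R <= B) ->
  (mu V <= B%:E)%E.
Proof.
move=> ab oV Vab VB.
have ba0 : 0 < b - a by rewrite subr_gt0.
have mV : measurable V by exact: open_measurable.
have Vfin : (@lebesgue_measure R V < +oo)%E.
  apply: (@le_lt_trans _ _ (@lebesgue_measure R `]a, b[)).
    exact: le_outer_measure.
  by rewrite lebesgue_measure_itv/= lte_fin ab ltry.
apply/lee_addgt0Pr => e e0.
have [L [cL LV Le]] := lebesgue_regularity_inner mV Vfin e0.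
rewrite -(setDKU LV) (le_trans (outer_measureU2 _ _ _))// addeC.
apply: leeD; last exact: ltW.
(* A Lebesgue number: compactness makes the radius uniform over [L]. *)
have [d d0 Ld] : exists2 d : R, 0 < d & forall x, L x -> forall y, `|y - x| <= d -> V y.
  pose P (d x : R) := forall y, `|y - x| <= d -> V y.
  have nP x : L x -> \forall x' \near x & d \near (0 : R)^'+, P d x'.
    move=> /LV Vx.
    have [r /= r0 rV] := (nbhs_ballP _ _).1 (open_nbhs_nbhs (conj oV Vx)).
    have r2 : 0 < r / 2 by rewrite divr_gt0.
    exists (ball x (r / 2), [set d : R | d < r / 2]) => /=.
      by split; [exact: nbhsx_ballx|exact: nbhs_right_lt].
    move=> [x' d] /= [xx' dr] y yx'; apply: rV; move: xx'; rewrite -!ball_normE/=.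
    move: yx' dr; rewrite !ltr_norml ler_norml; lra.
  have H : \forall d \near (0 : R)^'+, L `<=` P d.
    exact: (compact_near_coveringP L).1 cL _ (0 : R)^'+ P _ nP.
  near (0 : R)^'+ => d.
  have d0 : 0 < d by near: d; exact: nbhs_right_gt.
  have Pd : L `<=` P d by near: d.
  by exists d => // x /Pd.
have [N Nd] : exists N : nat, (b - a) / N.+1%:R <= d.
  exists (Num.trunc ((b - a) / d)).
  have /andP[_ H] := truncn_itv (divr_ge0 (ltW ba0) (ltW d0)).
  by rewrite ler_pdivrMr// mulrC -ler_pdivrMr// ltW.
set h := (b - a) / N.+1%:R in Nd *.
have h0 : 0 < h by rewrite divr_gt0.
pose cell (i : 'I_N.+1) : set R := [set` `[a + i%:R * h, a + i.+1%:R * h]].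
pose good : pred 'I_N.+1 := fun i => `[< cell i `<=` V >].
have VBg : h * #|good|%:R <= B.
  apply: VB => i x /asboolP iV xi; apply: iV.
  by rewrite /cell /= in_itv.
have Lcover : L `<=` \big[setU/set0]_(i < N.+1 | good i) cell i.
  move=> x Lx; have := Vab _ (LV _ Lx); rewrite /= in_itv/= => /andP[ax xb].
  have xa0 : 0 <= (x - a) / h by rewrite divr_ge0 ?subr_ge0 ?ltW.
  have /andP[k1 k2] := truncn_itv xa0.
  set k := Num.trunc _ in k1 k2.
  move: k1 k2; rewrite ler_pdivlMr// ltr_pdivrMr// => k1 k2.
  (* The strict inequality [x < b] keeps the index below [N.+1]. *)
  have kN : (k < N.+1)%N.
    rewrite -(ltr_nat R) -(ltr_pM2r h0) (le_lt_trans k1)//.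
    by rewrite /h mulrC divfK// ltrD2r.
  have xk : cell (Ordinal kN) x.
    by rewrite /cell /= in_itv/= -natr1 mulrDl mul1r; lra.
  have gk : good (Ordinal kN).
    apply/asboolP => y yk; apply: (Ld x Lx); move: xk yk.
    rewrite /cell /= !in_itv/= -natr1 mulrDl mul1r ler_norml; lra.
  by rewrite (bigD1 (Ordinal kN))//=; left.
apply: (@le_trans _ _ (mu (\big[setU/set0]_(i < N.+1 | good i) cell i))).
  exact: le_outer_measure.
apply: (@le_trans _ _ (\sum_(i < N.+1 | good i) h%:E)%E).
  elim/big_rec2: _ => [|i A s _ As]; first by rewrite measure0.
  rewrite (le_trans (outer_measureU2 _ _ _))// leeD//.
  rewrite [leLHS](_ : _ = @lebesgue_measure R (cell i))//.
  rewrite lebesgue_measure_itv/= lte_fin ltrD2l ltr_pM2r// ltr_nat ltnSn.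
  by rewrite -EFinD lee_fin -natr1 mulrDl mul1r; lra.
by rewrite sumEFin lee_fin sumr_const -[_ *+ _]mulr_natr.
Unshelve. all: by end_near. Qed.

(** [I] is covered by countably many open intervals with rational end points whose closures lie in
    [I]; codes of other pairs are sent to [set0]. *)
Lemma null_locally (N I : set R) : open I -> N `<=` I ->
  (forall a b, a < b -> (forall t, a <= t <= b -> I t) -> mu (N `&` `]a, b[) = 0%E) ->
  mu N = 0%E.
Proof.
move=> oI NI N0.
pose ok (p : rat * rat) := (ratr p.1 : R) < ratr p.2 /\
  forall t : R, ratr p.1 <= t <= ratr p.2 -> I t.
pose F (k : nat) : set R := if unpickle k is Some p then
  if `[< ok p >] then N `&` [set` `]ratr (p : rat * rat).1, ratr p.2[] else set0 else set0.
have F0 k : mu (F k) = 0%E.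
  rewrite /F; case: unpickle => [p|]; last exact: measure0.
  by case: ifPn => [/asboolP[pq pI]|_]; [exact: N0|exact: measure0].
have NF : N `<=` \bigcup_k F k.
  move=> x Nx; have [d /= d0 dI] := (nbhs_ballP _ _).1 (open_nbhs_nbhs (conj oI (NI x Nx))).
  have dx : x - d < x by rewrite ltrBlDr ltrDl.
  have xd : x < x + d by rewrite ltrDl.
  have [p] := rat_in_itvoo dx; have [q] := rat_in_itvoo xd.
  rewrite !in_itv/= => /andP[xq qd] /andP[dp px].
  have [k kE] : exists k, unpickle k = Some (p, q) by exists (pickle (p, q)); exact: pickleK.
  exists k => //; rewrite /F kE.
  have -> : `[< ok (p, q) >].
    apply/asboolP; split=> /= [|t tpq]; first exact: lt_trans px xq.
    by apply: dI; rewrite -ball_normE/= ltr_norml; move: tpq; lra.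
  by split=> //=; rewrite in_itv/= px.
apply/eqP; rewrite eq_le measure_ge0 andbT.
apply: (@le_trans _ _ (mu (\bigcup_k F k))); first exact: le_outer_measure.
have H : (mu (\bigcup_k F k) <= \sum_(0 <= k <oo) mu (F k))%E.
  exact: outer_measure_sigma_subadditive.
by move: H; rewrite eseries0.
Qed.

(** A set of outer measure 0 is Caratheodory measurable, so [E] is measurable for the completed
    measure even if it is not Borel. *)
Lemma conull_measurable (E I : set R) : open I -> E `<=` I -> mu (I `\` E) = 0%E ->
  lebesgue_measurable E /\ mu E = mu I.
Proof.
move=> oI EI N0.
have mI : lebesgue_measurable I by apply: sub_caratheodory; exact: open_measurable.
have mN : lebesgue_measurable (I `\` E).
  apply: le_caratheodory_measurable => X.
  have X0 : mu (X `&` (I `\` E)) = 0%E.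
    apply/eqP; rewrite eq_le measure_ge0 andbT -[leRHS]N0.
    exact: le_outer_measure.
  rewrite [A in (A + _ <= _)%E](_ : _ = 0%E) ?add0e//.
  exact: le_outer_measure.
split.
  rewrite (_ : E = I `\` (I `\` E)); last by rewrite setDD setIidr.
  exact: (@measurableD _ (caratheodory_type ((wlength (@idfun R))^*)%mu)).
apply/eqP; rewrite eq_le; apply/andP; split; first exact: le_outer_measure.
rewrite -(setDUK EI) (le_trans (outer_measureU2 _ _ _))//.
by rewrite [X in (_ + X <= _)%E](_ : _ = 0%E) ?adde0.
Qed.

End NullSets.

(** * Levels without short periods, and the capacity bound *)

Section Capacity.
Context (R : realType) (n : nat) (M : manifold R n) (w : M -> 'M[R]_n.+1)
  (U : set M) (tau : M -> R) (I : set R).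
Hypotheses (hw : symplectic w) (oU : open U).
Hypothesis U_interior : forall x c, U x -> atlas c -> cdom c x ->
  nbhs (c x) (cimg c).
Hypothesis tauC : smooth_from U (tau : _ -> R^o).
Hypothesis tau_regular : forall x, U x -> ham_field w tau x != 0.
Hypothesis slab : forall e, I e -> exists a b (K : set M),
  [/\ a < e < b, compact K, K `<=` U &
      forall x, U x -> a < tau x < b -> K x].

Lemma capacity_bound : (hz_capacity w U < +oo)%E -> exists2 B : R, 0 <= B &
  forall H m, hamiltonian U H m -> hz_admissible w U H -> m <= B.
Proof.
move=> capU.
have ub H m : hamiltonian U H m -> hz_admissible w U H ->
    (m%:E <= hz_capacity w U)%E.
  by move=> hH aH; apply: ereal_sup_ubound; exists m => //; exists H.
move: capU ub; case: (hz_capacity w U) => [r|//|] _ ub.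
  exists `|r| => // H m hH aH; have := ub H m hH aH; rewrite lee_fin => /le_trans; apply.
  exact: ler_norm.
(* A supremum equal to [-oo] leaves no admissible function to bound. *)
by exists 0 => // H m hH aH; have := ub H m hH aH; rewrite leeNy_eq.
Qed.

(** The complement in [I] of the set E_K of the overview. *)
Definition no_period (K : R) : set R :=
  [set e | I e /\ forall T, T <= K -> ~ periods w U tau I (e, T)].

(** A tube argument: a closed set of pairs (e, T) projects to a closed set along the compact
    interval [0, K]. At T = 0, [periods_closed] forbids the accumulation of ever shorter periods. *)
Lemma no_period_open K : open I -> open (no_period K).
Proof.
move=> oI; rewrite openE => e [Ie ne]; rewrite /interior.
pose P (e' T : R) := ~ periods w U tau I (e', T).
have nP T : `[0, K]%classic T -> \forall T' \near T & e' \near e, P e' T'.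
  move=> /=; rewrite in_itv/= => /andP[_ TK].
  have ncl : ~ closure (periods w U tau I) (e, T).
    move=> /(periods_closed hw oU U_interior tauC tau_regular slab)/(_ Ie).
    exact: ne.
  have : \forall q \near (e, T), ~ periods w U tau I q.
    have o : open (~` closure (periods w U tau I)).
      by apply: closed_openC; exact: closed_closure.
    apply: filterS (open_nbhs_nbhs (conj o ncl)) => q nq Pq.
    by apply: nq; exact: subset_closure.
  move=> [[A B] /= [nA nB] AB]; exists (B, A) => //= -[T' e'] /= [BT' Ae'].
  exact: (AB (e', T')).
have := (compact_near_coveringP _).1 (@segment_compact R 0 K) _ (nbhs e) P _ nP.
move=> /(_ _) H; apply: filterS (filterI (open_nbhs_nbhs (conj oI Ie)) H) => e' [Ie' Pe'].
split=> // T TK PT; apply: (Pe' T _ PT).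
by case: PT => _ /= T0 _; rewrite in_itv/= (ltW T0).
Qed.

End Capacity.

Section SmallGaps.
Context (R : realType) (n : nat) (M : manifold R n) (w : M -> 'M[R]_n.+1)
  (S : set M) (I : set R) (U : set M) (psi : M -> R -> M) (tau : M -> R).
Hypotheses (hw : symplectic w) (hS : hypersurface S) (hpsi : thickening S I U psi).
Hypothesis U_interior : forall x c, U x -> atlas c -> cdom c x ->
  nbhs (c x) (cimg c).
Hypothesis tauC : smooth_from U (tau : _ -> R^o).
Hypothesis tau_psi : forall x t, S x -> I t -> tau (psi x t) = t.
Hypothesis tau_regular : forall x, U x -> ham_field w tau x != 0.

Lemma levelP e x : I e -> [set psi y e | y in S] x <-> U x /\ tau x = e.
Proof.
have [_ [_ UE] _ _ _] := hpsi => Ie; split=> [[y Sy <-]|[Ux xe]].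
  by split; [rewrite -UE; exists y => //; exists e|exact: tau_psi].
have [y Sy [t It yt]] : [set psi x t | x in S & t in I] x by rewrite UE.
by exists y => //; rewrite -yt -xe -yt tau_psi.
Qed.

Lemma level_slab e : I e -> exists a b (K : set M),
  [/\ a < e < b, compact K, K `<=` U &
      forall x, U x -> a < tau x < b -> K x].
Proof.
have [[oI _] [_ UE] _ _ _] := hpsi => Ie.
have [d /= d0 dI] := (nbhs_ballP _ _).1 (open_nbhs_nbhs (conj oI Ie)).
have abI t : e - d / 2 <= t <= e + d / 2 -> I t.
  by move=> te; apply: dI; rewrite -ball_normE/= ltr_norml; lra.
exists (e - d / 2), (e + d / 2),
  [set psi x t | x in S & t in [set` `[e - d / 2, e + d / 2]]]; split.
- lra.
- exact: (compact_slab hS hpsi).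
- move=> _ [x Sx [t tab <-]]; rewrite -UE; exists x => //; exists t => //.
  by apply: abI; move: tab; rewrite /= in_itv.
- move=> x Ux xab; have [y Sy [t It yt]] : [set psi x t | x in S & t in I] x by rewrite UE.
  exists y => //; exists t => //=; rewrite in_itv/= -(tau_psi Sy It) yt; lra.
Qed.

Lemma no_period_small : (hz_capacity w U < +oo)%E -> exists2 C : R, 0 <= C &
  forall a b K, a < b -> (forall t, a <= t <= b -> I t) -> 0 < K ->
    (completed_lebesgue_measure (no_period w U tau I K `&` [set` `]a, b[]) <=
      (C / K)%:E)%E.
Proof.
move=> capU; have [B B0 capB] := capacity_bound capU.
have [C0 C00 pl] := @plateau R.
exists (B * C0) => [|a b K ab abI K0]; first by rewrite mulr_ge0// ltW.
have [[oI _] [oU _] _ _ _] := hpsi.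
have oV : open (no_period w U tau I K `&` [set` `]a, b[]).
  apply: openI; last exact: interval_open.
  exact: (no_period_open hw oU U_interior tauC tau_regular level_slab).
apply: (grid_bound ab oV) => [x []//|N good h goodV].
have h0 : 0 < h by rewrite divr_gt0// subr_gt0.
have bE : a + N.+1%:R * h = b by rewrite /h mulrC divfK// addrC subrK.
(* Without a good cell the profile has nowhere to climb, but then the length to be bounded is 0. *)
have [->|n0] := eqVneq #|good| 0%N.
  by rewrite mulr0; apply: divr_ge0; [exact: mulr_ge0 B0 (ltW C00)|exact: ltW].
rewrite -lt0n in n0.
have [f [fk f0 fm fc fD]] := pl _ a h K N.+1 good h0 K0 goodV n0.
rewrite bE in fm fc.
have hH := hamiltonian_of_profile hS hpsi U_interior tauC tau_psi fk f0 (ltW ab) abI fm fc.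
have aH : hz_admissible w U (f \o tau).
  apply: (admissible_of_profile (I := I) hw oU U_interior tauC fk _ _ fD).
    by move=> x [[Ix _] _].
  by move=> e T [[_ nP] _] TK PT; exact: (nP T TK PT).
have := capB _ _ hH aH.
by rewrite ler_pdivrMr// ler_pdivlMr// -mulrA mulrC.
Qed.

Lemma null_gaps (E : set R) : (hz_capacity w U < +oo)%E ->
  (forall e T, periods w U tau I (e, T) -> E e) ->
  completed_lebesgue_measure (I `\` E) = 0%E.
Proof.
move=> capU EP; have [C C0 CP] := no_period_small capU.
have [[oI _] _ _ _ _] := hpsi.
apply: (null_locally oI) => [x []//|a b ab abI].
apply/eqP; rewrite eq_le measure_ge0 andbT.
apply/lee_addgt0Pr => e e0; rewrite add0e.
(* This choice of K gives C / K = C e / (C + 1) <= e, and the added 1 keeps K positive when C =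
   0. *)
have K0 : 0 < (C + 1) / e by rewrite divr_gt0// ltr_wpDl.
apply: (@le_trans _ _ (completed_lebesgue_measure
    (no_period w U tau I ((C + 1) / e) `&` [set` `]a, b[]))).
  apply: le_outer_measure => x [[Ix nEx] xab]; split=> //; split=> // T _ PT.
  exact/nEx/EP/PT.
apply: le_trans (CP _ _ _ ab abI K0) _; rewrite lee_fin.
rewrite invf_div mulrA ler_pdivrMr; last by rewrite ltr_wpDl.
by rewrite mulrC ler_pM2l// lerDl.
Qed.

End SmallGaps.

Theorem theorem1 (R : realType) (n : nat) (M : manifold R n)
    (omega : M -> 'M[R]_n.+1) (S : set M) (I : set R) (U : set M)
    (psi : M -> R -> M) :
  symplectic omega ->
  hypersurface S ->
  thickening S I U psi ->
  (hz_capacity omega U < +oo)%E ->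
  let E := [set eps | I eps /\
              closed_characteristics omega [set psi x eps | x in S] !=set0] in
  lebesgue_measurable E /\
  completed_lebesgue_measure E = completed_lebesgue_measure I.
Proof.
move=> hw hS hpsi capU E.
have [[oI _] [oU _] _ [rho [tau [rhoC tauC inv_psi]]] _] := hpsi.
have U_int := thickening_nbhs_cimg hS hpsi rhoC tauC inv_psi.
have tau_psi x t : S x -> I t -> tau (psi x t) = t.
  by move=> Sx It; case: (inv_psi x t Sx It).
(* A zero of the field would be a zero of d tau, but d tau takes the value 1 on some vector. *)
have tau_reg x : U x -> ham_field omega tau x != 0.
  move=> Ux; have [ca cx] := chart_atP x.
  have [v Dv] := thickening_derive_tau hS hpsi rhoC tauC inv_psi Ux ca cx.
  apply: contra_eq_neq Dv => X0.
  have := pairing_ham_field hw oU U_int tauC v Ux.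
  rewrite (differentialE oU U_int tau v Ux) X0 /pairing !mul0mx mxE => /eqP.
  by rewrite eq_sym oppr_eq0 => /eqP ->; rewrite eq_sym oner_eq0.
have slab := level_slab hS hpsi tau_psi.
apply: conull_measurable => //; first by move=> e [].
apply: (null_gaps hw hS hpsi U_int tauC tau_psi tau_reg capU) => e T PT.
have Ie : I e by case: PT.
split=> //.
exact: (closed_characteristic_exists hw oU U_int tauC tau_reg slab
  (fun e x Ie => levelP hpsi tau_psi x Ie) PT).
Qed.
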